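(* Let $n\ge 2$ and let $M$ be a closed arithmetic hyperbolic $n$-manifold of type I. Then the set of all unit vectors tangent to nonsimple closed geodesics of $M$ is dense in the unit tangent bundle $T^1M$.
   Context: A geodesic in $M$ is simple if its image has no transverse self-intersections, and nonsimple otherwise. Arithmetic manifolds of type I: let $K\subset\mathbb R$ be a totally real algebraic number field with ring of integers $R_K$. A non-degenerate quadratic form $f(x)=\sum_{i,j=1}^{n+1}a_{ij}x_ix_j$ with $a_{ij}=a_{ji}\in K$ is admissible if its negative index is $1$ and, for every non-identity embedding $\sigma:K\to\mathbb R$, the form $f^\sigma(x)=\sum_{i,j}a_{ij}^{\sigma}x_ix_j$ is positive definite. Let $L\subset K^{n+1}$ be an $R_K$-lattice (for instance $L=R_K^{n+1}$), and let $O'(L)$ be the group of linear transformations preserving $f$, preserving $L$, and mapping each connected component of the cone $\{x\in\mathbb R^{n+1}: f(x)<0\}$ onto itself; it is a discrete group of isometries of $\mathbb H^n$. A torsion-free finite-index subgroup $\Gamma\le O'(L)$ is called an arithmetic lattice of type I, and $M=\Gamma\backslash\mathbb H^n$ is called an arithmetic (hyperbolic) $n$-manifold of type I. Closed means compact without boundary. *)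

(* Defs.v *)
From HB Require Import structures.
From mathcomp Require Import all_boot all_order all_algebra.
From mathcomp Require Import generic_quotient mxpoly fieldext.
From mathcomp Require Import complex.
From mathcomp Require Import all_classical all_reals all_analysis.

Set Implicit Arguments.
Unset Strict Implicit.
Unset Printing Implicit Defensive.

Import Order.TTheory GRing.Theory Num.Theory.
Import numFieldNormedType.Exports.

Local Open Scope classical_set_scope.
Local Open Scope ring_scope.
Local Open Scope quotient_scope.

(* Vectors are row vectors, and matrices act on them on the right. *)

Section Forms.
Context {R : comNzRingType} {m : nat}.
Implicit Types (A : 'M[R]_m) (x y : 'rV[R]_m).

Definition bform A x y : R := (x *m A *m y^T) 0 0.

Definition qform A x : R := bform A x x.

End Forms.

(* The number of negative coefficients in a diagonalization; it does not depend
   on the diagonalization, by Sylvester's law of inertia. *)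
Definition has_negative_index (R : realFieldType) (m : nat) (A : 'M[R]_m)
    (k : nat) : Prop :=
  exists (P : 'M[R]_m) (d : 'rV[R]_m),
    [/\ P \in unitmx, P *m A *m P^T = diag_mx d &
        #|[pred i | d 0 i < 0]| = k].

Definition positive_definite (R : realFieldType) (m : nat) (A : 'M[R]_m) :
  Prop := forall x : 'rV[R]_m, x != 0 -> 0 < qform A x.

Definition totally_real (R : realType) (K : fieldExtType rat) : Prop :=
  forall (s : {rmorphism K -> R[i]}) (x : K), complex.Im (s x) = 0.

Definition ring_of_integers (K : fieldExtType rat) : set K :=
  [set a | integralOver (intr : int -> K) a].

(* The field K is given with an embedding iota, which makes it a subfield of
   the reals; iota is then the identity embedding. *)
Definition admissible (R : realType) (K : fieldExtType rat)
    (iota : {rmorphism K -> R}) (m : nat) (A : 'M[K]_m) : Prop :=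
  [/\ A^T = A, A \in unitmx, has_negative_index (map_mx iota A) 1 &
      forall s : {rmorphism K -> R}, ~ (s =1 iota) ->
        positive_definite (map_mx s A)].

(* Finitely generated submodules over the ring of integers that span K^m; the
   rows of B are the generators. *)
Definition is_lattice (K : fieldExtType rat) (m : nat) (L : set 'rV[K]_m) :
    Prop :=
  exists (k : nat) (B : 'M[K]_(k, m)), row_full B /\
    L = [set c *m B | c in [set c : 'rV[K]_k |
                            forall i, ring_of_integers (c 0 i)]].

Definition negative_cone (R : realType) (m : nat) (A : 'M[R]_m) :
  set 'rV[R]_m := [set x | qform A x < 0].

Definition Oprime (R : realType) (K : fieldExtType rat)
    (iota : {rmorphism K -> R}) (m : nat) (A : 'M[K]_m) (L : set 'rV[K]_m) :
    set 'M[R]_m :=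
  let f := map_mx iota A in
  let LR := [set map_mx iota x | x in L] in
  [set g | [/\ forall x : 'rV[R]_m, qform f (x *m g) = qform f x,
               [set x *m g | x in LR] = LR &
               forall x, negative_cone f x ->
                 [set y *m g | y in connected_component (negative_cone f) x]
                 = connected_component (negative_cone f) x]].

Record mxgroup (R : comUnitRingType) (m : nat) := MxGroup {
  mxgroup_set :> set 'M[R]_m;
  mxgroup_unit : forall g, mxgroup_set g -> g \in unitmx;
  mxgroup1 : mxgroup_set 1%:M;
  mxgroupM : forall g h,
    mxgroup_set g -> mxgroup_set h -> mxgroup_set (g *m h);
  mxgroupV : forall g, mxgroup_set g -> mxgroup_set (invmx g)
}.

Definition finite_index (R : comUnitRingType) (m : nat) (G H : set 'M[R]_m) :
  Prop := finite_set [set [set h *m g | h in H] | g in G].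

Definition torsion_free (R : comUnitRingType) (n : nat) (G : set 'M[R]_n.+1) :
  Prop := forall g k, G g -> (0 < k)%N -> g ^+ k = 1 -> g = 1.

Definition arithmetic_lattice_typeI (R : realType) (K : fieldExtType rat)
    (iota : {rmorphism K -> R}) (n : nat) (A : 'M[K]_n.+1)
    (L : set 'rV[K]_n.+1) (Gamma : mxgroup R n.+1) : Prop :=
  [/\ Gamma `<=` Oprime iota A L, finite_index (Oprime iota A L) Gamma &
      torsion_free Gamma].

Section HyperbolicManifold.
Context {R : realType} {m : nat}.
(* The real matrix of the form, and a point o with qform A o < 0 selecting the
   sheet of the hyperboloid. *)
Variables (A : 'M[R]_m) (o : 'rV[R]_m) (Gamma : mxgroup R m).
Local Notation V := 'rV[R]_m.

Definition hyperboloid : set V :=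
  [set x | qform A x = -1 /\ connected_component (negative_cone A) o x].

Definition unit_tangent : set (V * V) :=
  [set p | [/\ hyperboloid p.1, bform A p.1 p.2 = 0 & qform A p.2 = 1]].

Local Notation Hn := (set_type hyperboloid).
Local Notation T1Hn := (set_type unit_tangent).

Definition same_orbit : rel Hn := fun x y =>
  `[< exists2 g, mxgroup_set Gamma g & val y = val x *m g >].

Definition same_orbit_T1 : rel T1Hn := fun p q =>
  `[< exists2 g, mxgroup_set Gamma g &
        val q = ((val p).1 *m g, (val p).2 *m g) >].

Lemma same_orbit_refl : reflexive same_orbit.
Proof.
by move=> x; apply/asboolP; exists 1%:M; [exact: mxgroup1 | rewrite mulmx1].
Qed.

Lemma same_orbit_sym : symmetric same_orbit.
Proof.
suff imp x y : same_orbit x y -> same_orbit y x.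
  by move=> x y; apply/idP/idP; exact: imp.
move=> /asboolP[g Gg e]; apply/asboolP.
exists (invmx g); first exact: mxgroupV.
by rewrite e mulmxK //; exact: mxgroup_unit Gg.
Qed.

Lemma same_orbit_trans : transitive same_orbit.
Proof.
move=> y x z /asboolP[g Gg e] /asboolP[h Gh e']; apply/asboolP.
by exists (g *m h); [exact: mxgroupM | rewrite e' e mulmxA].
Qed.

Lemma same_orbit_T1_refl : reflexive same_orbit_T1.
Proof.
move=> p; apply/asboolP; exists 1%:M; first exact: mxgroup1.
by rewrite !mulmx1; case: (val p).
Qed.

Lemma same_orbit_T1_sym : symmetric same_orbit_T1.
Proof.
suff imp p q : same_orbit_T1 p q -> same_orbit_T1 q p.
  by move=> p q; apply/idP/idP; exact: imp.
move=> /asboolP[g Gg e]; apply/asboolP.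
exists (invmx g); first exact: mxgroupV.
by have ug := mxgroup_unit Gg; rewrite e /= !mulmxK //; case: (val p).
Qed.

Lemma same_orbit_T1_trans : transitive same_orbit_T1.
Proof.
move=> q p r /asboolP[g Gg e] /asboolP[h Gh e']; apply/asboolP.
by exists (g *m h); [exact: mxgroupM | rewrite e' e /= !mulmxA].
Qed.

Canonical same_orbit_equiv :=
  EquivRel same_orbit same_orbit_refl same_orbit_sym same_orbit_trans.

Canonical same_orbit_T1_equiv := EquivRel same_orbit_T1
  same_orbit_T1_refl same_orbit_T1_sym same_orbit_T1_trans.

Definition manifold : topologicalType :=
  quotient_topology {eq_quot same_orbit_equiv}.

Definition T1manifold : topologicalType :=
  quotient_topology {eq_quot same_orbit_T1_equiv}.

Definition projM (x : Hn) : manifold := \pi_({eq_quot same_orbit_equiv}) x.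

Definition projT1 (p : T1Hn) : T1manifold :=
  \pi_({eq_quot same_orbit_T1_equiv}) p.

Definition position (c : R -> Hn) : R -> V := fun t => val (c t).

Definition velocity (c : R -> Hn) : R -> V := (position c)^`()%classic.

Definition acceleration (c : R -> Hn) : R -> V := (velocity c)^`()%classic.

(* Unit speed geodesics: the covariant derivative of the velocity on the
   hyperboloid is the tangential part of the acceleration, so that it vanishes
   if and only if the acceleration is orthogonal to the tangent space. *)
Definition is_geodesic (c : R -> Hn) : Prop :=
  [/\ forall t, derivable (position c) t 1,
      forall t, derivable (velocity c) t 1,
      forall t, qform A (velocity c t) = 1 &
      forall t w, bform A (position c t) w = 0 ->
        bform A (acceleration c t) w = 0].

(* The geodesics of the manifold are the curves t |-> projM (c t), where c is a
   geodesic of the hyperboloid. The predicates below are about such a curve,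
   expressed with its lift c. *)

Definition closed_geodesic (c : R -> Hn) : Prop :=
  is_geodesic c /\
  exists2 T : R, 0 < T & forall t, projM (c (t + T)) = projM (c t).

(* At a common point of the projected curve at the times s and t, the tangent
   spaces at c s and at c t are identified by an element g of Gamma mapping c s
   to c t; the crossing is transverse when the tangent lines are distinct. *)
Definition nonsimple (c : R -> Hn) : Prop :=
  exists s t g, [/\ mxgroup_set Gamma g, position c t = position c s *m g &
    row_free (col_mx (velocity c s *m g) (velocity c t))].

Definition tangent_to (c : R -> Hn) (u : T1manifold) : Prop :=
  exists (t : R) (p : T1Hn),
    val p = (position c t, velocity c t) /\ u = projT1 p.

Definition nonsimple_closed_tangents : set T1manifold :=
  [set u | exists c, [/\ closed_geodesic c, nonsimple c & tangent_to c u]].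

End HyperbolicManifold.

Arguments nonsimple_closed_tangents {R m} A o Gamma.

(* Main.v *)
From HB Require Import structures.
Require Import Defs.
From mathcomp Require Import all_boot all_order all_algebra.
From mathcomp Require Import falgebra fieldext separable algC algnum mxpoly.
From mathcomp Require Import complex ring lra.
From mathcomp Require Import all_classical all_reals all_analysis.

(** For a rational line, i.e. a plane spanned by orthogonal vectors e and u of
    K^(n+1) with f(e) < 0 < f(u), only finitely many images under Gamma of a
    basis of its orthogonal complement in the lattice are orthogonal to a point
    of a given bounded region: under the given embedding of K they are bounded
    by Cauchy-Schwarz on the complement of that point, under the other
    embeddings by definiteness, and algebraic integers with bounded conjugates
    are finitely many.  As the quotient is compact, the points of the line can
    be brought back to a bounded region, so by the pigeonhole principle some
    nontrivial element of Gamma fixes the orthogonal complement of the plane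
    pointwise; as Gamma is torsion-free, its square is a translation along the
    line.  Thus every rational line is closed in M.

    Given a unit tangent vector, choose a nearby rational line Q, with a
    translation h in Gamma fixing the complement of Q, and then tilt Q slightly
    off itself in a rational direction w orthogonal to it, to get a rational
    line P disjoint from Q but so close to it that h P meets P transversally.
    The line P is closed and nonsimple. *)

Set Implicit Arguments.
Unset Strict Implicit.
Unset Printing Implicit Defensive.

Import Order.TTheory GRing.Theory Num.Theory.
Import numFieldNormedType.Exports.

Local Open Scope classical_set_scope.
Local Open Scope ring_scope.

(** * Number fields *)

Section NumberField.
Context (K : fieldExtType rat).

Lemma primitive_element : exists q : K,
  forall x, exists p : {poly rat}, x = (map_poly (in_alg K) p).[q].
Proof.
have pc : [pchar K] =i pred0.
  by move=> p; rewrite (fmorph_pchar (in_alg K)) Num.Theory.pchar_num.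
have sep : separable 1 {:K}.
  by apply/separableP => y _; apply: pcharf0_separable.
exists (separable_generator 1 {:K}) => x.
have Kx : x \in <<1; separable_generator 1 {:K}>>%VS.
  by rewrite -(eq_adjoin_separable_generator sep (sub1v _)) memvf.
have /polyOver1P[p pE] := Fadjoin_polyOver 1 (separable_generator 1 {:K}) x.
by exists p; rewrite -pE Fadjoin_poly_eq.
Qed.

Lemma rational_minPoly (q : K) : exists m : {poly rat},
  map_poly (in_alg K) m = minPoly 1 q.
Proof. by have /polyOver1P[m ->] := minPolyOver 1 q; exists m. Qed.

Lemma embedding_of_root (F : numFieldType) (q : K) (m : {poly rat}) (z : F) :
  (forall x, exists p : {poly rat}, x = (map_poly (in_alg K) p).[q]) ->
  map_poly (in_alg K) m = minPoly 1 q -> root (map_poly ratr m) z ->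
  exists s : {rmorphism K -> F}, s q = z.
Proof.
move=> gen mE mz.
have vanish (p : {poly rat}) :
    (map_poly (in_alg K) p).[q] = 0 -> (map_poly ratr p).[z] = 0 :> F.
  move=> /eqP pq.
  have: minPoly 1 q %| map_poly (in_alg K) p.
    by apply: minPoly_dvdp pq; apply/polyOver1P; exists p.
  rewrite -mE dvdp_map -(dvdp_map (@ratr F)) => /dvdpP[r ->].
  by rewrite hornerM (eqP mz) mulr0.
have [px pxE] := choice gen.
pose s x : F := (map_poly ratr (px x)).[z].
have sE p : s (map_poly (in_alg K) p).[q] = (map_poly ratr p).[z].
  apply/eqP; rewrite -subr_eq0 -hornerN -hornerD -rmorphB /=; apply/eqP.
  by apply: vanish; rewrite rmorphB /= hornerD hornerN -pxE subrr.
have sB : zmod_morphism s.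
  move=> x y; rewrite {1}(pxE x) {1}(pxE y) -hornerN -hornerD -rmorphB sE.
  by rewrite rmorphB /= hornerD hornerN.
have sM : monoid_morphism s.
  split.
    have e1 : 1 = (map_poly (in_alg K) 1).[q] by rewrite rmorph1 -polyC1
      hornerC.
    by rewrite e1 sE rmorph1 -polyC1 hornerC.
  move=> x y; rewrite {1}(pxE x) {1}(pxE y) -hornerM -rmorphM sE.
  by rewrite rmorphM /= hornerM.
pose s' : {rmorphism K -> F} := HB.pack s
  (GRing.isZmodMorphism.Build _ _ s sB) (GRing.isMonoidMorphism.Build _ _ s sM).
exists s'; have := sE 'X; rewrite !map_polyX !hornerX => <- //.
Qed.

Context (R : realType).
Hypothesis Kreal : totally_real R K.

Lemma real_embedding (s : {rmorphism K -> R[i]}) :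
  exists t : {rmorphism K -> R}, forall x, s x = (t x)%:C%C.
Proof.
pose t x := complex.Re (s x).
have tE x : s x = (t x)%:C%C.
  by rewrite /t; have := Kreal s x; case: (s x) => a b /= ->.
have inj := @complexI R.
have tB : zmod_morphism t by move=> x y; apply: inj;
  rewrite -tE !rmorphB /= -!tE.
have tM : monoid_morphism t.
  by split=> [|x y]; apply: inj; rewrite -tE ?rmorph1 // !rmorphM /= -!tE.
pose t' : {rmorphism K -> R} := HB.pack t
  (GRing.isZmodMorphism.Build _ _ t tB) (GRing.isMonoidMorphism.Build _ _ t tM).
by exists t'.
Qed.

Lemma real_embeddings : exists (d : nat) (s : 'I_d -> {rmorphism K -> R})
    (e : 'I_d -> K),
  (forall x, exists c : 'I_d -> rat, x = \sum_i c i *: e i) /\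
  \matrix_(i, j) s j (e i) \in unitmx.
Proof.
have [q gen] := primitive_element; have [m mE] := rational_minPoly q.
have m_neq0 : m != 0.
  by rewrite -(map_poly_eq0 (in_alg K)) mE monic_neq0 // monic_minPoly.
have [r rE] := closed_field_poly_normal (map_poly (@ratr R[i]) m).
have lc0 : lead_coef (map_poly (@ratr R[i]) m) != 0.
  by rewrite lead_coef_eq0 map_poly_eq0.
have rroot z : z \in r -> root (map_poly ratr m) z.
  by move=> zr; rewrite rE rootZ // root_prod_XsubC.
have r_uniq : uniq r.
  rewrite -separable_prod_XsubC.
  have sepm : separable_poly m.
    rewrite -(separable_map (in_alg K)) mE; apply: pcharf0_separable.
    by move=> p; rewrite (fmorph_pchar (in_alg K)) Num.Theory.pchar_num.
  have : separable_poly (map_poly (@ratr R[i]) m) by rewrite separable_map.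
  by apply: dvdp_separable; rewrite [X in _ %| X]rE dvdpZr.
have rsz : size m = (size r).+1.
  by rewrite -(size_map_poly (@ratr R[i])) rE size_scale // size_prod_XsubC.
have embed (j : 'I_(size r)) : exists t : {rmorphism K -> R}, (t q)%:C%C = r`_j.
  have [s sq] := embedding_of_root gen mE (rroot _ (mem_nth 0 (ltn_ord j))).
  by have [t tE] := real_embedding s; exists t; rewrite -tE.
have [s sq] := choice embed.
exists (size r), s, (fun i => q ^+ i); split=> [x|].
  have [p ->] := gen x; exists (fun i => (p %% m)`_i).
  rewrite {1}(divp_eq p m) rmorphD rmorphM /= mE hornerD hornerM minPolyxx.
  rewrite mulr0 add0r (@horner_coef_wide _ (size r)); last first.
    by rewrite size_map_poly -ltnS -rsz ltn_modp.
  by apply: eq_bigr => i _; rewrite coef_map /= mulr_algl.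
have -> : \matrix_(i, j) s j (q ^+ i) =
    Vandermonde (size r) (\row_j s j q).
  by apply/matrixP => i j; rewrite !mxE rmorphXn.
rewrite unitmxE unitfE det_Vandermonde; apply/prodf_neq0 => i _.
apply/prodf_neq0 => j ij; rewrite !mxE subr_eq0; apply/eqP => sij.
have /eqP := congr1 (fun u => u%:C%C) sij; rewrite !sq nth_uniq //.
by rewrite gtn_eqF.
Qed.

End NumberField.

Lemma finite_set_mx (T : choiceType) (p q : nat) (S : set T) :
  finite_set S -> finite_set [set M : 'M[T]_(p, q) | forall i j, S (M i j)].
Proof.
move=> /finite_seqP[s ->].
apply: (@sub_finite_set _ _ [set \matrix_(i, j) val (f (i, j)) |
    f in [set: {ffun 'I_p * 'I_q -> seq_sub s}]]); last first.
  exact/finite_image/finite_finset.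
move=> M /= sM; exists [ffun ij => SeqSub (sM ij.1 ij.2)] => //.
by apply/matrixP => i j; rewrite mxE ffunE.
Qed.

Lemma finite_set_inj (T U : Type) (f : T -> U) (A : set T) (B : set U) :
  finite_set B -> {in A &, injective f} -> (forall x, A x -> B (f x)) ->
  finite_set A.
Proof.
move=> finB injf AB; rewrite -(eq_finite_set (inj_card_eq injf)).
by apply: sub_finite_set finB => _ [x Ax <-]; exact: AB.
Qed.

Lemma finite_bounded_int (n : nat) : finite_set [set z : int | `|z| <= n%:Z].
Proof.
apply: (@sub_finite_set _ _ [set i%:Z - n%:Z | i in `I_(n + n).+1]).
  move=> z; rewrite /= ler_norml => /andP[nz zn].
  have : 0 <= z + n%:Z by rewrite -lerBlDr sub0r.
  case E : (z + n%:Z) => [k|//] _; exists k; last by rewrite -E addrK.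
  by rewrite /= ltnS -lez_nat PoszD -E lerD2r.
exact/finite_image.
Qed.

Lemma rat_integral (F : numFieldType) (c : rat) :
  integralOver (intr : int -> F) (ratr c) -> c \is a Num.int.
Proof.
move=> [p mp].
have -> : map_poly intr p = map_poly ratr (map_poly (intr : int ->
  rat) p) :> {poly F}.
  by rewrite -map_poly_comp; apply: eq_map_poly => z /=; rewrite ratr_int.
rewrite fmorph_root => rc.
have : ratr c \in Aint.
  apply: (@root_monic_Aint (map_poly ratr (map_poly intr p))).
  - by rewrite fmorph_root.
  - by rewrite !monic_map.
  - apply/polyOverP => i; rewrite !coef_map /= ratr_int; exact: intr_int.
by move=> /(Cint_rat_Aint (Crat_rat _)); rewrite Cint_rat.
Qed.

Section Integers.
Context (K : fieldExtType rat).

Lemma integers_id (z : int) : @ring_of_integers K z%:~R.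
Proof. exact: (@integral_id _ _ (@intmul K 1)). Qed.

Lemma integersM (x y : K) :
  ring_of_integers x -> ring_of_integers y -> ring_of_integers (x * y).
Proof. exact: (@integral_mul _ _ (@intmul K 1)). Qed.

Lemma integersD (x y : K) :
  ring_of_integers x -> ring_of_integers y -> ring_of_integers (x + y).
Proof. exact: (@integral_add _ _ (@intmul K 1)). Qed.

Lemma integral_multiple (x : K) :
  exists2 D : int, D != 0 & ring_of_integers (D%:~R * x).
Proof.
have [m mE] := rational_minPoly x.
have [q [a a0 mq]] := rat_poly_scale m.
have aq i : a%:~R * m`_i = (q`_i)%:~R.
  by rewrite mq coefZ coef_map /= mulrA mulfV ?mul1r // intr_eq0.
have mm : m \is monic by rewrite -(map_monic (in_alg K)) mE monic_minPoly.
have m1 : (size m).-1.+1 = size m by rewrite prednK // size_poly_gt0 monic_neq0.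
have lcm : m`_(size m).-1 = 1 by rewrite -lead_coefE (monicP mm).
exists a => //; set n := (size m).-1 in m1 lcm.
pose r : {poly K} := \poly_(i < n.+1) (a%:~R ^+ (n - i) * in_alg K m`_i).
apply: (@integral_root_monic _ _ (@intmul K 1) _ r).
- by rewrite monicE lead_coef_poly // subnn mul1r lcm ?rmorph1 // oner_neq0.
- apply/rootP; rewrite horner_poly.
  have /rootP : root (map_poly (in_alg K) m) x by rewrite mE root_minPoly.
  rewrite horner_coef size_map_poly -m1 => mx.
  rewrite -[RHS](mulr0 (a%:~R ^+ n)) -[X in _ = _ * X]mx mulr_sumr.
  apply: eq_bigr => i _.
  rewrite coef_map /= exprMn.
  have -> : a%:~R ^+ n = a%:~R ^+ (n - i) * a%:~R ^+ i :> K.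
    by rewrite -exprD subnK // -ltnS.
  ring.
- apply/integral_poly => i; rewrite coef_poly; case: ltnP => [|_]; last first.
    exact: (integers_id 0).
  rewrite ltnS leq_eqVlt => /orP[/eqP ->|lin].
    by rewrite subnn mul1r lcm rmorph1; exact: (integers_id 1).
  have -> : a%:~R ^+ (n - i) * in_alg K m`_i = (a ^+ (n - i).-1 * q`_i)%:~R :>
    K.
    rewrite rmorphM rmorphXn /= -(rmorph_int (in_alg K) q`_i) -aq.
    rewrite rmorphM rmorph_int mulrA -exprSr prednK ?subn_gt0 //.
  exact: integers_id.
Qed.

Lemma common_integral_multiple (I : finType) (x : I -> K) :
  exists2 D : int, D != 0 & forall i, ring_of_integers (D%:~R * x i).
Proof.
have [D D0 Dx] : exists2 D : I -> int, (forall i, D i != 0) &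
    (forall i, ring_of_integers ((D i)%:~R * x i)).
  have /choice[D DP] : forall i, exists D : int,
    D != 0 /\ ring_of_integers (D%:~R * x i).
    by move=> i; have [D] := integral_multiple (x i); exists D.
  by exists D => i; have [] := DP i.
exists (\prod_i D i); first by apply/prodf_neq0 => i _.
move=> i; rewrite (bigD1 i) //= mulrC rmorphM /= mulrA.
apply: integersM; last exact: integers_id.
by rewrite mulrC; exact: Dx.
Qed.

Context (R : realType).
Hypothesis Kreal : totally_real R K.

Lemma trace_rational (d : nat) (s : 'I_d -> {rmorphism K -> R}) (e : 'I_d ->
  K) :
  (forall x, exists c : 'I_d -> rat, x = \sum_i c i *: e i) ->
  \matrix_(i, j) s j (e i) \in unitmx ->
  forall x, exists c : rat, \sum_j s j x = ratr c.
Proof.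
move=> gen; set V := \matrix_(i, j) _ => Vu x.
have [M ME] := choice (fun i => gen (x * e i)).
pose MR : 'M[R]_d := \matrix_(i, j) ratr (M i j).
have VM : V *m diag_mx (\row_j s j x) = MR *m V.
  apply/matrixP => i j; rewrite mul_mx_diag !mxE -rmorphM mulrC ME rmorph_sum.
  apply: eq_bigr => k _; rewrite !mxE -[M i k *: _]mulr_algl rmorphM /=.
  by congr (_ * _); rewrite -/(in_alg K (M i k)) -[LHS]/((s j \o in_alg K) _)
    fmorph_eq_rat.
exists (\sum_i M i i).
have -> : \sum_j s j x = \tr (diag_mx (\row_j s j x)).
  by rewrite mxtrace_diag; apply: eq_bigr => j _; rewrite mxE.
rewrite -[diag_mx _](mulKmx Vu) VM mxtrace_mulC mulmxK // rmorph_sum.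
by apply: eq_bigr => i _; rewrite mxE.
Qed.

(* With [f] an integral Q-basis of K, the integers Tr(a * f i) are bounded in
   terms of the conjugates of [a], and they determine [a]. *)
Lemma finite_bounded_integers (b : {rmorphism K -> R} -> R) :
  finite_set [set a : K | ring_of_integers a /\
    forall s : {rmorphism K -> R}, `|s a| <= b s].
Proof.
have [d [s [e [gen eu]]]] := real_embeddings Kreal.
have [D D0 De] := common_integral_multiple e.
have int_rmorph (t : {rmorphism K -> R}) x :
    ring_of_integers x -> integralOver (intr : int -> R) (t x).
  move=> /(integral_rmorph t); congr integralOver.
  by apply/funext => z /=; rewrite rmorph_int.
pose f i := D%:~R * e i.
have tr_int a i : ring_of_integers a ->
    exists z : int, \sum_j s j (a * f i) = z%:~R.
  move=> inta; have [c cE] := trace_rational gen eu (a * f i).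
  have /rat_integral /intrP[z cz] : integralOver (intr : int -> R) (ratr c).
    rewrite -cE; elim/big_ind : _ => [|x y|j _];
      first exact: (@mxpoly.integral0 _ _ (@intmul R 1)).
      exact: (@integral_add _ _ (@intmul R 1)).
    by apply: int_rmorph; apply: integersM => //; exact: De.
  by exists z; rewrite cE cz ratr_int.
have [T TE] : exists T : K -> 'rV[int]_d, forall a i, ring_of_integers a ->
    \sum_j s j (a * f i) = (T a 0 i)%:~R.
  have /choice[T TE] : forall a, exists T : 'rV[int]_d,
      forall i, ring_of_integers a -> \sum_j s j (a * f i) = (T 0 i)%:~R.
    move=> a; have [inta|ninta] := pselect (ring_of_integers a);
      last by exists 0.
    have [z zE] := choice (fun i => tr_int a i inta).
    by exists (\row_i z i) => i _; rewrite mxE.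
  by exists T.
pose B := \sum_i \sum_j `|b (s j)| * `|s j (f i)|.
have finB := finite_set_mx 1 d (finite_bounded_int (Num.bound B)).
apply: (@finite_set_inj _ _ T _ _ finB).
- move=> a a' /set_mem[inta _] /set_mem[inta' _] Taa'.
  pose V : 'M[R]_d := \matrix_(i, j) s j (e i).
  have : V *m \col_j s j (a - a') = 0.
    apply/colP => i; rewrite !mxE; apply/eqP.
    rewrite -(mulrI_eq0 _ (lregP (_ : D%:~R != 0))) ?intr_eq0 // mulr_sumr.
    have := TE a i inta; rewrite Taa' -(TE a' i inta') => /eqP.
    rewrite -subr_eq0 -sumrB; congr (_ == 0); apply: eq_bigr => j _.
    by rewrite !mxE /f !rmorphM /= rmorphB rmorph_int; ring.
  move=> /(congr1 (mulmx (invmx V))); rewrite mulKmx // mulmx0 => /colP.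
  have [d0|d0] := posnP d.
    have [c cE] := gen 1; move/eqP: cE; rewrite big1 ?oner_eq0 //.
    by move=> i; have := ltn_ord i; rewrite {2}d0.
  move=> /(_ (Ordinal d0)); rewrite !mxE => /eqP.
  by rewrite fmorph_eq0 subr_eq0 => /eqP.
- move=> a [inta ba] i k; rewrite ord1 /= -(ler_int R) intr_norm -TE //.
  apply: (@le_trans _ _ B).
    apply: (le_trans (ler_norm_sum _ _ _)).
    rewrite /B [leRHS](bigD1 k) //= -[leLHS]addr0; apply: lerD; last first.
      by apply: sumr_ge0 => l _; apply: sumr_ge0 => j _; rewrite mulr_ge0.
    apply: ler_sum => j _; rewrite rmorphM normrM ler_wpM2r //.
    exact: le_trans (ba _) (ler_norm _).
  apply/ltW/archi_boundP.
  by apply: sumr_ge0 => l _; apply: sumr_ge0 => j _; rewrite mulr_ge0.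
Qed.

End Integers.

(** * Quadratic forms and lattices *)

Section BilinearForm.
Context {F : comNzRingType} {m : nat}.
Implicit Types (A : 'M[F]_m) (x y z : 'rV[F]_m).

Lemma bformDl A x y z : bform A (x + y) z = bform A x z + bform A y z.
Proof. by rewrite /bform !mulmxDl mxE. Qed.

Lemma bformDr A x y z : bform A x (y + z) = bform A x y + bform A x z.
Proof. by rewrite /bform linearD mulmxDr mxE. Qed.

Lemma bformZl A a x y : bform A (a *: x) y = a * bform A x y.
Proof. by rewrite /bform -!scalemxAl mxE. Qed.

Lemma bformZr A a x y : bform A x (a *: y) = a * bform A x y.
Proof. by rewrite /bform linearZ -scalemxAr mxE. Qed.

Lemma bform0l A x : bform A 0 x = 0.
Proof. by rewrite -(scale0r 0) bformZl mul0r. Qed.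

Lemma bformC A x y : A^T = A -> bform A x y = bform A y x.
Proof.
move=> Asym; rewrite /bform -[in LHS](trmxK (x *m A *m y^T)) mxE.
by rewrite !trmx_mul trmxK Asym mulmxA.
Qed.

Lemma bform_mul A x y : (x *m A *m y^T) 0 0 = bform A x y.
Proof. by []. Qed.

Definition bformE := (bformDl, bformDr, bformZl, bformZr).

Lemma qformZ A a x : qform A (a *: x) = a ^+ 2 * qform A x.
Proof. by rewrite /qform bformZl bformZr mulrA. Qed.

Lemma qformD A x y : A^T = A ->
  qform A (x + y) = qform A x + qform A y + bform A x y *+ 2.
Proof.
move=> Asym; rewrite /qform !bformE (bformC y x Asym).
by rewrite mulr2n; ring.
Qed.

Lemma map_bform (E : comNzRingType) (f : {rmorphism F -> E}) A x y :
  bform (map_mx f A) (map_mx f x) (map_mx f y) = f (bform A x y).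
Proof. by rewrite /bform map_trmx -!map_mxM mxE. Qed.

Lemma map_qform (E : comNzRingType) (f : {rmorphism F -> E}) A x :
  qform (map_mx f A) (map_mx f x) = f (qform A x).
Proof. exact: map_bform. Qed.

End BilinearForm.

Section RealForm.
Context {R : realFieldType} {m : nat} (A : 'M[R]_m).
Hypothesis Asym : A^T = A.
Implicit Types (x y z : 'rV[R]_m) (g : 'M[R]_m).

Lemma isometry_bform g x y : (forall x, qform A (x *m g) = qform A x) ->
  bform A (x *m g) (y *m g) = bform A x y.
Proof.
move=> gP; have := gP (x + y); rewrite mulmxDl !qformD // !gP.
by move/addrI/eqP; rewrite -subr_eq0 -mulrnBl mulrn_eq0 /= subr_eq0 => /eqP.
Qed.

Lemma cauchy_schwarz x z :
  (forall s t, 0 <= qform A (s *: x + t *: z)) ->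
  bform A x z ^+ 2 <= qform A x * qform A z.
Proof.
move=> pos; set b := bform A x z; set p := qform A x; set q := qform A z.
have E s t : 0 <= s ^+ 2 * p + t ^+ 2 * q + 2 * (s * t * b).
  have := pos s t; rewrite qformD // !qformZ !bformE mulr2n.
  by rewrite -/p -/q -/b => /le_trans; apply; rewrite le_eqVlt; apply/orP;
    left; apply/eqP; ring.
have p0 : 0 <= p by have := E 1 0; lra.
have q0 : 0 <= q by have := E 0 1; lra.
have [qE|qn] := eqVneq q 0; last first.
  have qp : 0 < q by rewrite lt_neqAle eq_sym qn.
  have : 0 <= q * (p * q - b ^+ 2) by have := E q (- b); lra.
  by rewrite pmulr_rge0 // subr_ge0.
have [pE|pn] := eqVneq p 0; last first.
  have pp : 0 < p by rewrite lt_neqAle eq_sym pn.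
  have : 0 <= p * (p * q - b ^+ 2) by have := E (- b) p; lra.
  by rewrite pmulr_rge0 // subr_ge0.
have b0 : b = 0 by have := E 1 1; have := E 1 (-1); rewrite pE qE; lra.
by rewrite b0 pE qE; lra.
Qed.

Hypothesis Aunit : A \in unitmx.

Lemma coord_bform x (j : 'I_m) : x 0 j = bform A x (row j (invmx A)).
Proof.
rewrite /bform rowE trmx_mul trmx_inv Asym mulmxA mulmxK //.
by rewrite trmx_delta -colE mxE.
Qed.

Lemma positive_definite_coord_le x (j : 'I_m) : positive_definite A ->
  x 0 j ^+ 2 <= qform A x * qform A (row j (invmx A)).
Proof.
move=> pos; rewrite coord_bform; apply: cauchy_schwarz => s t.
have [->|nz] := eqVneq (s *: x + t *: row j (invmx A)) 0.
  by rewrite /qform bform0l.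
exact/ltW/pos.
Qed.

Hypothesis Aneg : has_negative_index A 1.

Lemma timelike_orthogonal_gt0 x y :
  qform A y < 0 -> bform A x y = 0 -> x != 0 -> 0 < qform A x.
Proof.
have [P [d [Pu PAP /eqP]]] := Aneg.
rewrite -/(#|_|) => /card1P[i0 /= i0P].
have d_neq0 i : d 0 i != 0.
  have : P *m A *m P^T \in unitmx by rewrite !unitmx_mul unitmx_tr Pu Aunit.
  rewrite PAP unitmxE det_diag unitfE => /prodf_neq0; exact.
have d_gt0 i : i != i0 -> 0 < d 0 i.
  move=> ii0; rewrite lt_neqAle eq_sym d_neq0 /= leNgt.
  by have := i0P i; rewrite !inE (negPf ii0) => ->.
have qE u : qform A (u *m P) = \sum_i d 0 i * u 0 i ^+ 2.
  rewrite /qform /bform trmx_mul !mulmxA.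
  rewrite -[u *m P *m A]mulmxA -[u *m (P *m A) *m P^T]mulmxA PAP.
  rewrite mul_mx_diag mxE; apply: eq_bigr => i _; rewrite !mxE; ring.
have pos (u : 'rV[R]_m) : u 0 i0 = 0 -> 0 <= qform A (u *m P) /\
    (qform A (u *m P) <= 0 -> u = 0).
  move=> u0; have term i : 0 <= d 0 i * u 0 i ^+ 2.
    have [->|/d_gt0 /ltW di] := eqVneq i i0; first by rewrite u0 expr0n mulr0.
    by rewrite mulr_ge0 // sqr_ge0.
  rewrite qE; split=> [|le0]; first exact: sumr_ge0.
  have /eqP : \sum_i d 0 i * u 0 i ^+ 2 = 0.
    by apply/eqP; rewrite eq_le le0 sumr_ge0.
  rewrite psumr_eq0 // => /allP z; apply/rowP => i; rewrite mxE; apply/eqP.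
  have := z i (mem_index_enum _); rewrite mulf_eq0 (negPf (d_neq0 i)) /=.
  by rewrite sqrf_eq0.
move=> qy bxy x0; rewrite ltNge; apply/negP => qx.
pose u := x *m invmx P; pose v := y *m invmx P.
have xE : x = u *m P by rewrite mulmxKV.
have yE : y = v *m P by rewrite mulmxKV.
pose z := v 0 i0 *: u + (- u 0 i0) *: v.
have qz : qform A (z *m P) = v 0 i0 ^+ 2 * qform A x + u 0 i0 ^+ 2 * qform A y.
  rewrite mulmxDl -!scalemxAl -xE -yE qformD // !qformZ !bformE bxy.
  by rewrite sqrrN mulr2n; ring.
have [] := pos z; first by rewrite !mxE; ring.
move=> _; rewrite qz => zP.
have t1 : v 0 i0 ^+ 2 * qform A x <= 0 by rewrite mulr_ge0_le0 ?sqr_ge0.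
have t2 : u 0 i0 ^+ 2 * qform A y <= 0 by rewrite mulr_ge0_le0 ?sqr_ge0 // ltW.
have {}zP : z = 0 by apply: zP; lra.
have v0 : v 0 i0 != 0.
  by apply/eqP => /pos[+ _]; rewrite -yE leNgt qy.
have : qform A (z *m P) = 0 by rewrite zP mul0mx /qform bform0l.
rewrite qz => z0; have /eqP : u 0 i0 ^+ 2 * qform A y = 0 by lra.
rewrite mulf_eq0 (lt_eqF qy) orbF sqrf_eq0 => /eqP u0.
move/eqP: zP; rewrite /z u0 oppr0 scale0r addr0 scalemx_eq0 (negPf v0) /=.
by move=> /eqP u00; move: x0; rewrite xE u00 mul0mx eqxx.
Qed.

Lemma timelike_orthogonal_ge0 x y :
  qform A y < 0 -> bform A x y = 0 -> 0 <= qform A x.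
Proof.
move=> qy bxy; have [->|x0] := eqVneq x 0; first by rewrite /qform bform0l.
exact/ltW/(timelike_orthogonal_gt0 qy).
Qed.

(* Cauchy-Schwarz on the orthogonal complement of [y]. *)
Lemma timelike_orthogonal_coord_le x y (j : 'I_m) :
  qform A y = -1 -> bform A x y = 0 ->
  x 0 j ^+ 2 <= qform A x * (qform A (row j (invmx A)) + y 0 j ^+ 2).
Proof.
move=> qy bxy; have qy0 : qform A y < 0 by rewrite qy ltrN10.
set z := row j (invmx A); pose z' := z + y 0 j *: y.
have yj : y 0 j = bform A z y by rewrite coord_bform bformC.
have zy : bform A z' y = 0 by rewrite !bformE -yj -/(qform A y) qy; ring.
have -> : qform A z + y 0 j ^+ 2 = qform A z'.
  by rewrite qformD // qformZ bformZr -yj qy mulr2n; ring.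
have -> : x 0 j = bform A x z' by rewrite coord_bform !bformE bxy mulr0 addr0.
apply: cauchy_schwarz => s t; apply: (timelike_orthogonal_ge0 qy0).
by rewrite bformDl 2!bformZl bxy zy; ring.
Qed.

End RealForm.

Section Lattice.
Context (K : fieldExtType rat) (R : realType) (m : nat).
Hypothesis Kreal : totally_real R K.
Variable L : set 'rV[K]_m.
Hypothesis latL : is_lattice L.

Lemma lattice_multiple (p : nat) (N : 'M[K]_(p, m)) :
  exists2 D : int, D != 0 & forall i, L (row i (D%:~R *: N)).
Proof.
have [k [B [fullB ->]]] := latL.
have [C CB] : exists C, N = C *m B.
  by apply/submxP; apply: submx_full.
have [D D0 DP] := common_integral_multiple (fun ij : 'I_p * 'I_k => C ij.1
  ij.2).
exists D => // i; exists (row i (D%:~R *: C)); last first.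
  by rewrite -row_mul -scalemxAl -CB.
by move=> j; rewrite !mxE; exact: (DP (i, j)).
Qed.

Lemma lattice_integral : exists2 D : int, D != 0 &
  forall w, L w -> forall j, ring_of_integers (D%:~R * w 0 j).
Proof.
have [k [B [fullB ->]]] := latL.
have [D D0 DP] := common_integral_multiple (fun ij : 'I_k * 'I_m => B ij.1
  ij.2).
exists D => // w [c cint <-] j; rewrite mxE mulr_sumr.
elim/big_ind : _ => [|x y|i _]; first exact: (integers_id K 0).
  exact: integersD.
by rewrite mulrCA; apply: integersM; [exact: cint | exact: (DP (i, j))].
Qed.

Lemma finite_bounded_lattice (b : {rmorphism K -> R} -> R) :
  finite_set [set w | L w /\
    forall (s : {rmorphism K -> R}) j, `|s (w 0 j)| <= b s].
Proof.
have [D D0 DP] := lattice_integral.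
have DK : D%:~R != 0 :> K.
  by rewrite -(rmorph_int (in_alg K)) fmorph_eq0 intr_eq0.
have finS := finite_bounded_integers Kreal (fun s => `|D%:~R| * b s).
apply: (@finite_set_inj _ _ (fun w : 'rV[K]_m => D%:~R *: w) _ _
  (finite_set_mx 1 m finS)).
  by move=> w w' _ _; apply: scalerI.
move=> w [Lw bw] i j; rewrite ord1 mxE; split; first exact: DP.
by move=> s; rewrite rmorphM rmorph_int normrM ler_wpM2l.
Qed.

Variables (iota : {rmorphism K -> R}) (A : 'M[K]_m).
Hypothesis admA : admissible iota A.

(* The vectors in question are bounded under iota by Cauchy-Schwarz on the
   orthogonal complement of y, and under any other embedding s by
   Cauchy-Schwarz for the positive definite form A^s. *)
Lemma finite_lattice_orthogonal (c : K) (r : R) :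
  finite_set [set w | [/\ L w, qform A w = c & exists y : 'rV[R]_m,
    [/\ qform (map_mx iota A) y = -1, forall j, `|y 0 j| <= r &
        bform (map_mx iota A) (map_mx iota w) y = 0]]].
Proof.
have [Asym Au Aneg Apos] := admA.
have sym (s : {rmorphism K -> R}) : (map_mx s A)^T = map_mx s A.
  by rewrite map_trmx Asym.
have unit (s : {rmorphism K -> R}) : map_mx s A \in unitmx by rewrite
  map_unitmx.
pose b (s : {rmorphism K -> R}) : R := 1 + \sum_j
  `|s c| * (`|qform (map_mx s A) (row j (invmx (map_mx s A)))| + r ^+ 2).
apply: sub_finite_set (finite_bounded_lattice b) => w [Lw qw [y [qy yr wy]]].
split=> // s j.
have le_sq (a : R) : `|a| <= 1 + a ^+ 2.
  by rewrite -[a ^+ 2]real_normK ?num_real //; have := normr_ge0 a; nra.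
apply: (le_trans (le_sq _)); rewrite lerD2l /b (bigD1 j) //=.
rewrite -[leLHS]addr0; apply: lerD; last first.
  by apply: sumr_ge0 => k _; rewrite mulr_ge0 // addr_ge0 // sqr_ge0.
have -> : s (w 0 j) = map_mx s w 0 j by rewrite mxE.
have norm_le (p q t : R) : p <= s c * q -> q <= t -> 0 <= s c ->
  p <= `|s c| * t.
  by move=> pq qt sc; rewrite ger0_norm //; apply: (le_trans pq);
    rewrite ler_wpM2l.
have [si|ns] := pselect (s =1 iota).
  have mapE (p : nat) (N : 'M[K]_(p, m)) : map_mx s N = map_mx iota N.
    by apply/matrixP => k l; rewrite !mxE si.
  have scE : s c = qform (map_mx iota A) (map_mx iota w).
    by rewrite map_qform qw si.
  apply: norm_le.
  - rewrite scE (mapE 1%N w).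
    exact: (timelike_orthogonal_coord_le (sym iota) (unit iota) Aneg j qy wy).
  - rewrite mapE; apply: lerD; first exact: ler_norm.
    by rewrite -[y 0 j ^+ 2]real_normK ?num_real // ler_sqr ?nnegrE //
      (le_trans _ (yr j)).
  - rewrite scE; apply: (timelike_orthogonal_ge0 (sym iota) (unit iota) Aneg _
      wy).
    by rewrite qy ltrN10.
have scE : s c = qform (map_mx s A) (map_mx s w) by rewrite map_qform qw.
have posA := Apos s ns.
apply: norm_le.
- by rewrite scE; apply: positive_definite_coord_le.
- by rewrite -[leLHS]addr0; apply: lerD; [exact: ler_norm | exact: sqr_ge0].
- rewrite scE; have [->|/posA/ltW//] := eqVneq (map_mx s w) 0.
  by rewrite /qform bform0l.
Qed.

End Lattice.

(** * Boosts along rational lines *)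

Section Hyperbolic.
Context {R : realType}.
Implicit Types s t : R.

Definition cosh t : R := (expR t + expR (- t)) / 2.

Definition sinh t : R := (expR t - expR (- t)) / 2.

Lemma cosh2_sinh2 t : cosh t ^+ 2 - sinh t ^+ 2 = 1.
Proof.
by rewrite -[RHS](expRxMexpNx_1 t) /cosh /sinh; field.
Qed.

Lemma coshD s t : cosh (s + t) = cosh s * cosh t + sinh s * sinh t.
Proof. by rewrite /cosh /sinh opprD !expRD; field. Qed.

Lemma sinhD s t : sinh (s + t) = sinh s * cosh t + cosh s * sinh t.
Proof. by rewrite /cosh /sinh opprD !expRD; field. Qed.

Lemma coshN t : cosh (- t) = cosh t.
Proof. by rewrite /cosh opprK addrC. Qed.

Lemma sinhN t : sinh (- t) = - sinh t.
Proof. by rewrite /sinh opprK -mulNr opprB. Qed.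

Lemma cosh0 : cosh 0 = 1.
Proof. by rewrite /cosh oppr0 expR0; field. Qed.

Lemma sinh0 : sinh 0 = 0.
Proof. by rewrite /sinh oppr0 subrr mul0r. Qed.

Lemma cosh_gt0 t : 0 < cosh t.
Proof. by rewrite /cosh divr_gt0 // addr_gt0 // expR_gt0. Qed.

Lemma cosh_ge_norm t : `|t| / 2 <= cosh t.
Proof.
rewrite /cosh ler_pM2r ?invr_gt0 //.
have := expR_ge1Dx t; have := expR_ge1Dx (- t).
have := expR_gt0 t; have := expR_gt0 (- t).
by case: (ger0P t) => ?; lra.
Qed.

End Hyperbolic.

Section Boost.
Context {R : realType} {n : nat} (f : 'M[R]_n.+1).
Hypothesis fsym : f^T = f.
Hypothesis funit : f \in unitmx.
Hypothesis fneg : has_negative_index f 1.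
Variables (x v : 'rV[R]_n.+1).
Hypotheses (qx : qform f x = -1) (qv : qform f v = 1) (bxv : bform f x v = 0).

Let bvx : bform f v x = 0. Proof. by rewrite bformC. Qed.

Lemma orthogonal_decomposition (y : 'rV[R]_n.+1) :
  exists2 z, bform f z x = 0 /\ bform f z v = 0 &
    y = (- bform f y x) *: x + bform f y v *: v + z.
Proof.
exists (y - ((- bform f y x) *: x + bform f y v *: v));
  last by rewrite addrC subrK.
rewrite -[- (_ + _)]scaleN1r !bformE -!/(qform _ _) qx qv bxv bvx.
by split; ring.
Qed.

Definition line (t : R) : 'rV[R]_n.+1 := cosh t *: x + sinh t *: v.

Lemma bform_line s t : bform f (line s) (line t) = - cosh (s - t).
Proof.
rewrite /line !bformE -!/(qform _ _) qx qv bxv bvx coshD coshN sinhN; ring.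
Qed.

Lemma line_ortho (w : 'rV[R]_n.+1) t :
  bform f w x = 0 -> bform f w v = 0 -> bform f w (line t) = 0.
Proof. by move=> wx wv; rewrite bformDr !bformZr wx wv !mulr0 addr0. Qed.

(* An isometry of the plane spanned by [x] and [v] is a boost, up to sign, or
   an involution. *)
Lemma square_is_boost (g : 'M[R]_n.+1) :
  (forall y, qform f (y *m g) = qform f y) ->
  (forall w, bform f w x = 0 -> bform f w v = 0 -> w *m g = w) ->
  g *m g != 1%:M ->
  exists2 l : R, l != 0 & x *m (g *m g) = cosh l *: x + sinh l *: v /\
    v *m (g *m g) = sinh l *: x + cosh l *: v.
Proof.
move=> isog fixg gg1.
have bg y z : bform f (y *m g) (z *m g) = bform f y z by exact: isometry_bform.
have stable y : (forall z, bform f z x = 0 -> bform f z v = 0 ->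
  bform f y z = 0) ->
    exists a b, y *m g = a *: x + b *: v.
  move=> yP; have [z [zx zv] yE] := orthogonal_decomposition (y *m g).
  exists (- bform f (y *m g) x), (bform f (y *m g) v).
  have z0 : qform f z = 0.
    have : bform f (y *m g) z = 0 by rewrite -(fixg z zx zv) bg yP.
    rewrite {1}yE !bformDl !bformZl !(bformC _ z fsym) zx zv.
    by rewrite !mulr0 !add0r.
  have [z00|znz] := eqVneq z 0; first by rewrite {1}yE z00 addr0.
  have := timelike_orthogonal_gt0 fsym funit fneg _ zx znz.
  by rewrite qx z0 ltxx => /(_ (ltrN10 _)).
have [a [b xg]] : exists a b, x *m g = a *: x + b *: v.
  by apply: stable => z zx _; rewrite bformC.
have [c [d vg]] : exists c d, v *m g = c *: x + d *: v.
  by apply: stable => z _ zv; rewrite bformC.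
have ab : a ^+ 2 - b ^+ 2 = 1.
  have := isog x; rewrite xg /qform !bformE -!/(qform _ _) qx qv bxv bvx; lra.
have cd : d ^+ 2 - c ^+ 2 = 1.
  have := isog v; rewrite vg /qform !bformE -!/(qform _ _) qx qv bxv bvx; lra.
have acbd : a * c = b * d.
  have := bg x v; rewrite xg vg /qform !bformE -!/(qform _ _) qx qv bxv bvx;
    lra.
have xgg : x *m (g *m g) = (a ^+ 2 + b * c) *: x + (a * b + b * d) *: v.
  rewrite mulmxA xg mulmxDl -!scalemxAl xg vg !scalerDr !scalerA addrACA
    -!scalerDl.
  by rewrite expr2.
have vgg : v *m (g *m g) = (c * a + d * c) *: x + (c * b + d ^+ 2) *: v.
  rewrite mulmxA vg mulmxDl -!scalemxAl xg vg !scalerDr !scalerA addrACA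
    -!scalerDl.
  by rewrite expr2.
have not_id : ~ [/\ a ^+ 2 + b * c = 1, a * b + b * d = 0, c * a + d * c = 0 &
    c * b + d ^+ 2 = 1].
  move=> [e1 e2 e3 e4]; move/eqP: gg1; apply; apply/row_matrixP => i.
  rewrite -[g *m g]mul1mx row_mul; set y := row i _.
  have [z [zx zv] ->] := orthogonal_decomposition y.
  rewrite 2!mulmxDl -!scalemxAl xgg vgg e1 e2 e3 e4 mulmxA !fixg //.
  by rewrite !scale0r !scale1r addr0 add0r.
have b0 : b != 0.
  apply/eqP => b0; rewrite b0 expr0n /= subr0 mul0r in ab acbd.
  have a0 : a != 0 by apply/eqP => a0; move/eqP: ab;
    rewrite a0 expr0n eq_sym oner_eq0.
  have c0 : c = 0 by apply/eqP; rewrite -(mulrI_eq0 _ (lregP a0)) acbd.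
  by apply: not_id; rewrite b0 c0; rewrite c0 expr0n /= subr0 in cd; split; lra.
have c2 : c ^+ 2 = b ^+ 2.
  have /(congr1 (fun y => y ^+ 2)) := acbd.
  rewrite !exprMn; nra.
have /orP[/eqP cb|/eqP cb] : (c == b) || (c == - b).
- by rewrite -subr_eq0 -addr_eq0 -mulf_eq0 -subr_sqr c2 subrr.
- have da : d = a by apply: (mulfI b0); rewrite -acbd cb mulrC.
  have ab1 : (a + b) ^+ 2 * (a - b) ^+ 2 = 1.
    by rewrite -exprMn mulrC -subr_sqr ab expr1n.
  have pos : 0 < (a + b) ^+ 2.
    rewrite lt_neqAle sqr_ge0 andbT eq_sym; apply/eqP => z.
    by move: ab1; rewrite z mul0r => /esym/eqP; rewrite oner_eq0.
  have el : expR (ln ((a + b) ^+ 2)) = (a + b) ^+ 2 by rewrite lnK.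
  have eNl : expR (- ln ((a + b) ^+ 2)) = (a - b) ^+ 2.
    rewrite expRN el; apply: (mulfI (lt0r_neq0 pos)).
    by rewrite ab1 mulfV ?lt0r_neq0.
  exists (ln ((a + b) ^+ 2)).
    apply/eqP => l0; rewrite l0 oppr0 expR0 in el eNl.
    have /eqP : b ^+ 2 = 0 by nra.
    by rewrite sqrf_eq0 (negPf b0).
  rewrite xgg vgg /cosh /sinh el eNl cb da.
  by split; congr (_ *: _ + _ *: _); field.
- have da : d = - a by apply: (mulfI b0); rewrite -acbd cb; ring.
  by exfalso; apply: not_id; rewrite cb da; split; lra.
Qed.

End Boost.

Section RationalBoost.
Context (R : realType) (K : fieldExtType rat) (iota : {rmorphism K -> R}).
Context (n : nat) (A : 'M[K]_n.+1) (L : set 'rV[K]_n.+1) (Gamma : mxgroup R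
  n.+1).
Hypothesis Kreal : totally_real R K.
Hypothesis admA : admissible iota A.
Hypothesis latL : is_lattice L.
Hypothesis GammaO : Gamma `<=` Oprime iota A L.
Hypothesis Gammatf : torsion_free Gamma.
Local Notation f := (map_mx iota A).
Local Notation G := (mxgroup_set Gamma).

Lemma real_form_sym : f^T = f.
Proof. by have [Asym _ _ _] := admA; rewrite map_trmx Asym. Qed.

Lemma real_form_unit : f \in unitmx.
Proof. by have [_ Au _ _] := admA; rewrite map_unitmx. Qed.

Lemma Gamma_isometry g y : G g -> qform f (y *m g) = qform f y.
Proof. by move=> /GammaO[isog _ _]. Qed.

(* The boost is a quotient of two elements of Gamma bringing back to a bounded
   region points far apart on the line, and acting in the same way on a
   rational basis of the complement of the plane; they exist since there are
   finitely many possible actions. *)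
Lemma rational_boost (x v : 'rV[R]_n.+1) (e u : 'rV[K]_n.+1) (a b r : R) :
  map_mx iota e = a *: x -> map_mx iota u = b *: v -> a != 0 -> b != 0 ->
  qform f x = -1 -> qform f v = 1 -> bform f x v = 0 ->
  (forall t, exists2 g, G g & forall j, `|(line x v t *m g) 0 j| <= r) ->
  exists2 h, G h & exists2 l : R, l != 0 &
    [/\ x *m h = cosh l *: x + sinh l *: v, v *m h = sinh l *: x + cosh l *: v &
        forall w, bform f w x = 0 -> bform f w v = 0 -> w *m h = w].
Proof.
move=> ex uv a0 b0 qx qv bxv bounded.
have fsym := real_form_sym; have funit := real_form_unit.
have [_ _ fneg _] := admA.
have bvx : bform f v x = 0 by rewrite bformC.
pose B := \sum_i \sum_j r * `|f i j| * r.
have bB (y z : 'rV[R]_n.+1) : (forall j, `|y 0 j| <= r) ->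
  (forall j, `|z 0 j| <= r) ->
    `|bform f y z| <= B.
  move=> yr zr; have r0 : 0 <= r by rewrite (le_trans _ (yr 0)).
  rewrite /bform mxE (le_trans (ler_norm_sum _ _ _)) // /B exchange_big /=.
  apply: ler_sum => j _; rewrite !mxE mulr_suml (le_trans (ler_norm_sum _ _ _))
    //.
  by apply: ler_sum => i _; rewrite !normrM; do !apply: ler_pM.
pose T := 2 * B + 1.
have B0 : 0 <= B.
  have [g _ gr] := bounded 0.
  exact: le_trans (normr_ge0 _) (bB _ _ gr gr).
have /choice[g gP] : forall k : nat, exists g, G g /\
    forall j, `|(line x v (k%:R * T) *m g) 0 j| <= r.
  by move=> k; have [g] := bounded (k%:R * T); exists g.
have g_inj k l : k != l -> g k != g l.
  wlog lk : k l / (l < k)%N.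
    move=> W; rewrite neq_ltn => /orP[kl|lk].
      by rewrite eq_sym; apply: W; rewrite ?neq_ltn kl ?orbT.
    by apply: W => //; rewrite neq_ltn lk orbT.
  move=> _; apply/eqP => gkl; have [Gk kr] := gP k; have [_ lr] := gP l.
  have := bB _ _ kr lr; rewrite -gkl isometry_bform //; last first.
    by move=> y; apply: Gamma_isometry.
  rewrite bform_line // normrN gtr0_norm ?cosh_gt0 // leNgt => /negP; apply.
  apply: lt_le_trans (cosh_ge_norm _); rewrite -mulrBl -natrB; last exact: ltnW.
  have kl1 : 1 <= (k - l)%:R :> R by rewrite ler1n subn_gt0.
  have T0 : 0 < T by rewrite /T; lra.
  rewrite ger0_norm ?mulr_ge0 // ?(ltW T0) // ltr_pdivlMr //.
  by apply: (@lt_le_trans _ _ T); [rewrite /T; lra | rewrite ler_peMl // ltW].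
pose N0 := kermx (A *m (col_mx e u)^T).
have [D D0 ND] := lattice_multiple latL N0.
set N := D%:~R *: N0 in ND.
have Northo i : bform f (map_mx iota (row i N)) x = 0 /\
    bform f (map_mx iota (row i N)) v = 0.
  have /(congr1 (row i)) : N *m (A *m (col_mx e u)^T) = 0.
    by rewrite -scalemxAl mulmx_ker scaler0.
  rewrite row0 !row_mul tr_col_mx mulmxA mul_mx_row => /eqP.
  rewrite -row_mx0 => /eqP/eq_row_mx[Ne Nu]; split.
    apply: (mulfI a0); rewrite -bformZr -ex map_bform.
    by rewrite /bform Ne mxE rmorph0 mulr0.
  apply: (mulfI b0); rewrite -bformZr -uv map_bform.
  by rewrite /bform Nu mxE rmorph0 mulr0.
have Nspan w : bform f w x = 0 -> bform f w v = 0 ->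
    exists c, w = c *m map_mx iota N.
  move=> wx wv; apply/submxP.
  have DR : D%:~R != 0 :> R by rewrite intr_eq0.
  rewrite map_mxZ rmorph_int (eqmx_scale _ DR) map_kermx sub_kermx.
  rewrite map_mxM mulmxA -map_trmx map_col_mx tr_col_mx mul_mx_row -row_mx0.
  apply/eqP; congr row_mx; apply/rowP => j; rewrite ord1 [RHS]mxE.
    by rewrite bform_mul ex bformZr wx mulr0.
  by rewrite bform_mul uv bformZr wv mulr0.
have img k i : exists w, L w /\ map_mx iota w = map_mx iota (row i N) *m g k.
  have [/GammaO[_ gL _] _] := gP k.
  have : [set y *m g k | y in [set map_mx iota y | y in L]]
      (map_mx iota (row i N) *m g k).
    by exists (map_mx iota (row i N)) => //; exists (row i N) => //; exact: ND.
  by rewrite gL => -[w Lw wE]; exists w.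
have [w0 w0P] := choice (fun ki => img ki.1 ki.2).
pose w k i := w0 (k, i).
have wP k i : L (w k i) /\ map_mx iota (w k i) = map_mx iota (row i N) *m g k.
  exact: (w0P (k, i)).
have finW i := finite_lattice_orthogonal Kreal latL admA (qform A (row i N)) r.
pose W i := [set w | [/\ L w, qform A w = qform A (row i N) &
  exists y : 'rV[R]_n.+1, [/\ qform f y = -1, forall j, `|y 0 j| <= r &
        bform f (map_mx iota w) y = 0]]].
have wW k i : W i (w k i).
  have [Lw wE] := wP k i; have [Gk kr] := gP k; split=> //.
    apply: (fmorph_inj iota); rewrite -!map_qform wE; exact: Gamma_isometry.
  exists (line x v (k%:R * T) *m g k); split=> //.
    rewrite Gamma_isometry // /qform bform_line // subrr cosh0 //.
  rewrite wE isometry_bform //; last by move=> y; apply: Gamma_isometry.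
  by have [] := Northo i; exact: line_ortho.
have [k [l [kl wkl]]] : exists k l, k != l /\ w k =1 w l.
  apply: contrapT => no; apply: infinite_nat.
  have finU : finite_set (\bigcup_(i in [set: 'I_n.+1]) W i).
    apply: bigcup_finite => [|i _]; first exact: finite_finset.
    exact: finW.
  apply: (@finite_set_inj _ _ (fun k => \col_i w k i) _ _
    (finite_set_mx n.+1 1 finU)).
    move=> k l _ _ /colP wkl; apply: contrapT => /eqP kl; apply: no.
    by exists k, l; split=> // i; have := wkl i; rewrite !mxE.
  by move=> k _ i j; rewrite mxE; exists i.
have [Gk _] := gP k; have [Gl _] := gP l.
pose h := g k *m invmx (g l).
have Gh : G h by apply: mxgroupM => //; apply: mxgroupV.
have uk := mxgroup_unit Gk; have ul := mxgroup_unit Gl.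
have Nh : map_mx iota N *m h = map_mx iota N.
  apply/row_matrixP => i; rewrite row_mul -map_row mulmxA.
  by have [_ <-] := wP k i; rewrite wkl; have [_ ->] := wP l i; rewrite mulmxK.
have fixh y : bform f y x = 0 -> bform f y v = 0 -> y *m h = y.
  by move=> yx yv; have [c ->] := Nspan y yx yv; rewrite -mulmxA Nh.
have hh1 : h *m h != 1%:M.
  apply/eqP => hh1; have /Gammatf : G h by [].
  move=> /(_ 2%N isT); rewrite expr2 => /(_ hh1) h1.
  have /negP := g_inj _ _ kl; apply; apply/eqP.
  by rewrite -[g k](mulmxKV ul) -/h h1 mul1mx.
have [y|m m0 [xm vm]] := square_is_boost fsym funit fneg qx qv bxv _ fixh hh1.
  exact: Gamma_isometry.
exists (h *m h); first exact: mxgroupM.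
by exists m => //; split=> // y yx yv; rewrite mulmxA !fixh.
Qed.

End RationalBoost.

(** * Bounded representatives *)

Section Limits.
Context {R : realType} {T : Type} (F : set_system T) {FF : Filter F}.

Lemma cvg_row (m : nat) (h : T -> 'rV[R]_m) (l : 'rV[R]_m) :
  (forall j, h t 0 j @[t --> F] --> l 0 j) -> h t @[t --> F] --> l.
Proof.
move=> hl B [P lP PB].
have : \forall t \near F, forall j, P 0 j (h t 0 j).
  by apply: filter_forall => j; apply: hl; exact: lP.
by apply: filterS => t Pt; apply: PB => i j; rewrite ord1.
Qed.

Lemma cvg_bform (m : nat) (A : 'M[R]_m) (h k : T -> 'rV[R]_m) (l p : 'rV[R]_m) :
  h t @[t --> F] --> l -> k t @[t --> F] --> p ->
  bform A (h t) (k t) @[t --> F] --> bform A l p.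
Proof.
move=> hl kp.
have entry (g : T -> 'rV[R]_m) (q : 'rV[R]_m) j : g t @[t --> F] --> q ->
    g t 0 j @[t --> F] --> q 0 j.
  by move=> gq; exact: (@cvg_comp _ _ _ g (fun M : 'rV[R]_m => M 0 j) F (nbhs
    q) _ gq
      (@coord_continuous R 1 m 0 j q)).
have E y z : bform A y z = \sum_j (\sum_i y 0 i * A i j) * z 0 j.
  by rewrite /bform mxE; apply: eq_bigr => j _; rewrite !mxE.
rewrite E; under eq_fun do rewrite E.
apply: cvg_big => [|j _]; first exact: add_continuous.
apply: cvgM; last exact: entry.
apply: cvg_big => [|i _]; first exact: add_continuous.
by apply: cvgM; [exact: entry | exact: cvg_cst].
Qed.

Lemma cvg_qform (m : nat) (A : 'M[R]_m) (h : T -> 'rV[R]_m) (l : 'rV[R]_m) :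
  h t @[t --> F] --> l -> qform A (h t) @[t --> F] --> qform A l.
Proof. by move=> hl; apply: cvg_bform. Qed.

Lemma cvg_invsqrt (h : T -> R) (l : R) : 0 < l -> h t @[t --> F] --> l ->
  (Num.sqrt (h t))^-1 @[t --> F] --> (Num.sqrt l)^-1.
Proof.
move=> l0 hl; apply: cvgV; first by rewrite gt_eqF // sqrtr_gt0.
exact: (continuous_cvg _ (@sqrt_continuous R l) hl).
Qed.

End Limits.

Lemma near_rational (R : realType) (K : fieldExtType rat)
    (iota : {rmorphism K -> R}) (m : nat) (x : 'rV[R]_m) (P : set 'rV[R]_m) :
  nbhs x P -> exists w : 'rV[K]_m, P (map_mx iota w).
Proof.
move=> [Q xQ QP].
have near j : exists q : rat, Q 0 j (ratr q).
  have /nbhs_ballP[e e0 eQ] := xQ 0 j.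
  have : x 0 j < x 0 j + e by rewrite ltrDl.
  move=> /rat_in_itvoo[q]; rewrite in_itv /= => /andP[xq qe].
  exists q; apply: eQ; rewrite /ball /= ltr_distlC.
  by rewrite qe andbT (lt_trans _ xq) // ltrBlDr ltrDl.
have [q qQ] := choice near.
exists (\row_j in_alg K (q j)); apply: QP => i j; rewrite ord1 !mxE.
by rewrite -[iota _]/((iota \o in_alg K) _) fmorph_eq_rat; exact: qQ.
Qed.

Section Sheets.
Context {R : realType} {m : nat} (f : 'M[R]_m).
Hypothesis fsym : f^T = f.

Lemma same_sheet (x y : 'rV[R]_m) : qform f x < 0 -> qform f y < 0 ->
  bform f x y < 0 -> connected_component (negative_cone f) x y.
Proof.
move=> qx qy bxy; pose h (s : R) : 'rV[R]_m := (1 - s) *: x + s *: y.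
have h0 : h 0 = x by rewrite /h subr0 scale1r scale0r addr0.
have h1 : h 1 = y by rewrite /h subrr scale1r scale0r add0r.
have seg : (h @` `[0, 1]) x by exists 0 => //=; rewrite in_itv /= lexx ler01.
apply: (connected_component_max seg).
- move=> z [s /=]; rewrite in_itv /= => /andP[s0 s1] <-.
  rewrite /negative_cone /= /h qformD // !qformZ bformZl bformZr mulr2n.
  have [->|ns] := eqVneq s 0; first by lra.
  have s0' : 0 < s by rewrite lt_neqAle eq_sym ns.
  have t1 : (1 - s) ^+ 2 * qform f x <= 0 by rewrite mulr_ge0_le0 ?sqr_ge0 //
    ltW.
  have t2 : s ^+ 2 * qform f y < 0 by rewrite pmulr_rlt0 // exprn_gt0.
  have t3 : (1 - s) * (s * bform f x y) <= 0.
    by rewrite mulr_ge0_le0 ?subr_ge0 // pmulr_rle0 // ltW.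
  by lra.
- apply: connected_continuous_connected; first exact: segment_connected.
  apply: continuous_subspaceT => s; apply: cvg_row => j.
  under eq_fun do rewrite !mxE.
  rewrite !mxE; apply: cvgD; apply: cvgM; try exact: cvg_cst;
    last exact: cvg_id.
  by apply: cvgB; [exact: cvg_cst | exact: cvg_id].
- by exists 1 => //=; rewrite in_itv /= lexx ler01.
Qed.

End Sheets.

Lemma set_val_continuous (T : topologicalType) (D : set T) :
  continuous (@set_val T D).
Proof. exact: initial_continuous. Qed.

Section BoundedOrbits.
Context {R : realType} {m : nat} (f : 'M[R]_m) (o : 'rV[R]_m) (Gamma : mxgroup
  R m).
Local Notation G := (mxgroup_set Gamma).
Hypothesis Gamma_hyperboloid : forall g x,
  G g -> hyperboloid f o x -> hyperboloid f o (x *m g).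

Lemma projM_eq (x y : set_type (hyperboloid f o)) :
  (exists2 g, G g & val y = val x *m g) <-> projM Gamma x = projM Gamma y.
Proof.
by split=> [xy|/eqmodP/asboolP//]; apply/eqmodP/asboolP.
Qed.

Lemma open_bounded_orbits (r : R) : open [set z : set_type (hyperboloid f o) |
  exists2 g, G g & forall j, `|(set_val z *m g) 0 j| < r].
Proof.
rewrite openE => z [g Gg zr].
have near j : \forall z' \near z, `|(set_val z' *m g) 0 j| < r.
  have E (y : 'rV[R]_m) : (y *m g) 0 j = bform g y (delta_mx 0 j).
    by rewrite /bform trmx_delta -colE !mxE.
  have cv : bform g (set_val z') (delta_mx 0 j) @[z' --> z] -->
      bform g (set_val z) (delta_mx 0 j).
    have zc : set_val z' @[z' --> z] --> set_val z by exact: set_val_continuous.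
    by apply: cvg_bform zc _; exact: cvg_cst.
  have zr' : `|bform g (set_val z) (delta_mx 0 j)| < r by rewrite -E; exact: zr.
  near=> z'; rewrite E; near: z'.
  exact: (cvgr_lt _ (cvg_norm cv) _ zr').
by near=> z'; exists g => //; near: z'; exact: filter_forall.
Unshelve. all: by end_near. Qed.

Lemma compact_bounded_orbits : compact [set: manifold f o Gamma] ->
  exists r : R, forall x, hyperboloid f o x ->
    exists2 g, G g & forall j, `|(x *m g) 0 j| <= r.
Proof.
move=> /compact_near_coveringP cM.
pose P (k : nat) (u : manifold f o Gamma) :=
  exists2 y : set_type (hyperboloid f o), projM Gamma y = u &
    forall j, `|val y 0 j| <= k%:R.
have := cM nat \oo P _; case.
- move=> u _; pose x : set_type (hyperboloid f o) := repr u.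
  have xu : projM Gamma x = u by exact: reprK.
  pose k := (Num.bound (\sum_j `|val x 0 j|)).
  have xk j : `|val x 0 j| < k%:R.
    apply: (@le_lt_trans _ _ (\sum_j `|val x 0 j|)).
      by rewrite (bigD1 j) //= lerDl sumr_ge0.
    by apply: archi_boundP; rewrite sumr_ge0.
  pose U : set (manifold f o Gamma) := [set u |
    exists2 y : set_type (hyperboloid f o), projM Gamma y = u &
      forall j, `|val y 0 j| < k%:R].
  exists (U, [set l | (k <= l)%N]) => /=.
    split; last by exists k.
    apply: (@open_nbhs_nbhs (manifold f o Gamma) u U); split; last by exists x.
    suff : open (projM Gamma @^-1` U) by [].
    suff -> : projM Gamma @^-1` U = [set z | exists2 g, G g &
        forall j, `|(set_val z *m g) 0 j| < k%:R] by exact: open_bounded_orbits.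
    apply/seteqP; split=> [z [y yz yk]|z [g Gg gk]].
      have [g Gg gE] := (projM_eq z y).2 (esym yz).
      by exists g => // j; rewrite -gE; exact: yk.
    exists (SigSub (mem_set (Gamma_hyperboloid Gg (set_valP z)))) => //=.
    by apply/esym/projM_eq; exists g.
  move=> [u' l] /= [[y yu yk] kl]; exists y => // j.
  by rewrite (le_trans (ltW (yk j))) // ler_nat.
- move=> k _ /(_ k (leqnn k)) kP.
  exists k%:R => x hx; pose x' : set_type (hyperboloid f o) :=
    SigSub (mem_set hx).
  have [y yx yk] := kP (projM Gamma x') I.
  have [g Gg gE] := (projM_eq x' y).2 (esym yx).
  by exists g => // j; rewrite -gE.
Qed.

End BoundedOrbits.

(** * Geodesic lines *)

Section HyperbolicCalculus.
Context {R : realType}.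
Implicit Types s t : R.

Lemma is_derive_cosh_sinh t :
  is_derive t 1 (@cosh R) (sinh t) /\ is_derive t 1 (@sinh R) (cosh t).
Proof.
have dN : is_derive t 1 (fun s : R => expR (- s)) (- expR (- t)).
  have := is_derive1_comp (is_derive_expR (- t)) (is_deriveNid t 1).
  by rewrite mulrN1.
have half (g h : R -> R) dg : (forall s, h s = g s / 2) ->
    is_derive t 1 g dg -> is_derive t 1 h (dg / 2).
  move=> hE dg'; have -> : h = 2^-1 \*: g.
    by apply/funext => s; rewrite hE mulrC.
  by rewrite mulrC; exact: is_deriveZ.
split; first exact: (half _ cosh _ (fun=> erefl) (is_deriveD (is_derive_expR t)
  dN)).
have := half _ sinh _ (fun=> erefl) (is_deriveB (is_derive_expR t) dN).
by rewrite opprK.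
Qed.

Lemma is_derive_line n (x v : 'rV[R]_n.+1) t :
  is_derive t 1 (line x v) (line v x t).
Proof.
have entry j : is_derive t 1 (fun s => line x v s 0 j) (line v x t 0 j).
  have [dc ds] := is_derive_cosh_sinh t.
  have -> : (fun s => line x v s 0 j) = x 0 j \*: cosh + v 0 j \*: sinh.
    by apply/funext => s; rewrite !mxE mulrC [X in _ + X]mulrC.
  apply: is_derive_eq; rewrite !mxE addrC mulrC [X in _ + X]mulrC //.
have D : derivable (line x v) t 1.
  by apply/derivable_mxP => i j; rewrite ord1; have [] := entry j.
apply: DeriveDef => //; rewrite derive_mx //; apply/matrixP => i j.
by rewrite mxE ord1; have [_ ->] := entry j.
Qed.

Lemma cosh_sinh_surj (a b : R) : 0 < a -> a ^+ 2 - b ^+ 2 = 1 ->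
  exists t, cosh t = a /\ sinh t = b.
Proof.
move=> a0 ab; have ab1 : (a + b) * (a - b) = 1 by rewrite mulrC -subr_sqr.
have pos : 0 < a + b by nra.
have el : expR (ln (a + b)) = a + b by rewrite lnK.
have eNl : expR (- ln (a + b)) = a - b.
  by rewrite expRN el; apply: (mulfI (lt0r_neq0 pos));
    rewrite ab1 mulfV ?lt0r_neq0.
by exists (ln (a + b)); rewrite /cosh /sinh el eNl; split; field.
Qed.

Lemma sinh_neq0 t : t != 0 -> sinh t != 0.
Proof.
apply: contra => /eqP; rewrite /sinh => st0.
have /expR_inj tN : expR t = expR (- t) by lra.
by apply/eqP; lra.
Qed.

End HyperbolicCalculus.

Section Lines.
Context {R : realType} {n : nat} (f : 'M[R]_n.+1) (o : 'rV[R]_n.+1)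
  (Gamma : mxgroup R n.+1).
Local Notation G := (mxgroup_set Gamma).
Hypothesis fsym : f^T = f.
Variables (x v : 'rV[R]_n.+1).
Hypotheses (hx : hyperboloid f o x) (qv : qform f v = 1) (bxv : bform f x v =
  0).

Lemma line_hyperboloid t : hyperboloid f o (line x v t).
Proof.
have [qx cx] := hx; have q t' : qform f (line x v t') = -1.
  by rewrite /qform bform_line // subrr cosh0.
split=> //; apply: connected_component_trans cx _.
have x0 : x = line x v 0 by rewrite /line cosh0 sinh0 scale1r scale0r addr0.
rewrite {1}x0; apply: same_sheet => //; rewrite ?q ?ltrN10 //.
by rewrite bform_line // oppr_lt0 cosh_gt0.
Qed.

Definition line_lift (t : R) : set_type (hyperboloid f o) :=
  SigSub (mem_set (line_hyperboloid t)).

Lemma position_line_lift : position line_lift = line x v.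
Proof. by []. Qed.

Lemma velocity_line_lift : velocity line_lift = line v x.
Proof.
apply/funext => t; rewrite /velocity derive1E.
exact: (@derive_val _ _ _ _ _ _ _ (is_derive_line x v t)).
Qed.

Lemma geodesic_line_lift : is_geodesic line_lift.
Proof.
have [qx _] := hx; have bvx : bform f v x = 0 by rewrite bformC.
split=> [t|t|t|t w].
- by have [] := is_derive_line x v t.
- by rewrite velocity_line_lift; have [] := is_derive_line v x t.
- rewrite velocity_line_lift /line /qform !bformE -!/(qform _ _) qx qv bxv bvx.
  by rewrite -[RHS](cosh2_sinh2 t); ring.
- rewrite position_line_lift /acceleration velocity_line_lift derive1E.
  by rewrite (@derive_val _ _ _ _ _ _ _ (is_derive_line v x t)).
Qed.

Lemma line_boost (h : 'M[R]_n.+1) (l t : R) :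
  x *m h = cosh l *: x + sinh l *: v -> v *m h = sinh l *: x + cosh l *: v ->
  line x v t *m h = line x v (t + l).
Proof.
move=> xh vh; rewrite /line mulmxDl -!scalemxAl xh vh !scalerDr !scalerA
  addrACA.
by rewrite -!scalerDl coshD sinhD [sinh t * cosh l + _]addrC.
Qed.

Lemma closed_line_lift (h : 'M[R]_n.+1) (l : R) : G h -> l != 0 ->
  x *m h = cosh l *: x + sinh l *: v -> v *m h = sinh l *: x + cosh l *: v ->
  closed_geodesic Gamma line_lift.
Proof.
move=> Gh l0 xh vh; split; first exact: geodesic_line_lift.
have step t : projM Gamma (line_lift t) = projM Gamma (line_lift (t + l)).
  by apply/projM_eq; exists h => //; rewrite (line_boost t xh vh).
exists `|l| => [|t]; first by rewrite normr_gt0.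
have [l_gt0|l_lt0|l00] := ltgtP 0 l.
- by rewrite gtr0_norm // -step.
- by rewrite ltr0_norm // step subrK.
- by move: l0; rewrite -l00 eqxx.
Qed.

End Lines.

(* The line through [p] in the direction [v] and the axis of [h] have a common
   perpendicular, from [p] to [x], so that the former meets its translate by [h]
   if and only if it has points above the midpoint of [x] and [x *m h]: this is
   the condition [kb], in which [b] is the hyperbolic tangent of [l / 2]. *)
Section Crossing.
Context {R : realType} {n : nat} (f : 'M[R]_n.+1).
Hypothesis fsym : f^T = f.
Variables (x v w : 'rV[R]_n.+1) (h : 'M[R]_n.+1) (l d k : R).
Hypotheses (qv : qform f v = 1) (bxv : bform f x v = 0).
Hypotheses (bwx : bform f w x = 0) (bwv : bform f w v = 0) (qw : 0 < qform f w).
Hypotheses (xh : x *m h = cosh l *: x + sinh l *: v)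
  (vh : v *m h = sinh l *: x + cosh l *: v) (wh : w *m h = w).
Hypotheses (l0 : l != 0) (d0 : d != 0) (k0 : 0 < k).
Local Notation p := (k *: (x + d *: w)).
Local Notation b := (sinh l / (cosh l + 1)).
Hypothesis kb : (k * b) ^+ 2 < 1.

Lemma line_crossing : exists t,
  line p v t = line p v (- t) *m h /\
  row_free (col_mx (line v p (- t) *m h) (line v p t)).
Proof.
have bvx : bform f v x = 0 by rewrite bformC.
have bvw : bform f v w = 0 by rewrite bformC.
have bxw : bform f x w = 0 by rewrite bformC.
have c1 : cosh l + 1 != 0 by rewrite gt_eqF // addr_gt0 ?cosh_gt0.
have chE : cosh l ^+ 2 = 1 + sinh l ^+ 2 by have := cosh2_sinh2 l; lra.
pose C := (Num.sqrt (1 - (k * b) ^+ 2))^-1.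
have s0 : 0 < 1 - (k * b) ^+ 2 by rewrite subr_gt0.
have C0 : 0 < C by rewrite invr_gt0 sqrtr_gt0.
have CE : C ^+ 2 * (1 - (k * b) ^+ 2) = 1.
  by rewrite exprVn sqr_sqrtr ?ltW // mulVf // gt_eqF.
have [t [ct st]] : exists t, cosh t = C /\ sinh t = k * b * C.
  by apply: cosh_sinh_surj => //; rewrite -[RHS]CE; ring.
have e2 : sinh l = b * (cosh l + 1) by rewrite divfK.
have e1 : cosh l - b * sinh l = 1.
  apply: (mulIf c1); have := congr1 (fun y => sinh l * y) e2.
  by move: chE; set b' := b; lra.
have ph : p *m h = k *: (cosh l *: x + sinh l *: v + d *: w).
  by rewrite -scalemxAl mulmxDl -scalemxAl xh wh.
exists t; split.
  rewrite /line coshN sinhN ct st mulmxDl -scalemxAl ph -scalemxAl vh;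
    apply/rowP => j; rewrite !mxE.
  have E1 := congr1 (fun y => C * k * x 0 j * y) e1.
  have E2 := congr1 (fun y => C * k * v 0 j * y) e2.
  by move: E1 E2; set b' := b; lra.
apply: inj_row_free => u; rewrite -[u]hsubmxK mul_row_col.
rewrite [lsubmx u]mx11_scalar [rsubmx u]mx11_scalar !mul_scalar_mx.
set a1 := lsubmx u 0 0; set a2 := rsubmx u 0 0 => u0.
suff [-> ->] : a1 = 0 /\ a2 = 0 by rewrite !raddf0 row_mx0.
have V1 : line v p (- t) *m h = C *: (sinh l *: x + cosh l *: v) -
    (k * b * C) *: (k *: (cosh l *: x + sinh l *: v + d *: w)).
  by rewrite /line coshN sinhN ct st mulmxDl -scalemxAl vh -scalemxAl ph
    scaleNr.
have V2 : line v p t = C *: v + (k * b * C) *: p by rewrite /line ct st.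
move: u0; rewrite V1 V2 => u0.
have ew := congr1 (fun y => bform f y w) u0.
have ev := congr1 (fun y => bform f y v) u0.
rewrite -scaleNr !bformE !bform0l bxw bvw bxv bwv -!/(qform _ _) qv in ew ev.
have nz : k * b * C * k * d * qform f w != 0.
  have kn : k != 0 by rewrite gt_eqF.
  have Cn : C != 0 by rewrite gt_eqF.
  have qn : qform f w != 0 by rewrite gt_eqF.
  have bn : b != 0 by rewrite mulf_neq0 ?invr_neq0 ?sinh_neq0.
  by rewrite mulf_neq0 ?qn // mulf_neq0 ?d0 // mulf_neq0 ?kn // mulf_neq0 ?Cn
    // mulf_neq0.
have a12 : a2 = a1.
  apply/eqP; rewrite -subr_eq0 -(mulrI_eq0 _ (lregP nz)); apply/eqP.
  by move: ew; set b' := b; set q' := qform f w; lra.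
have a10 : a1 = 0.
  have nz' : C * (cosh l + 1) * (1 - (k * b) ^+ 2) != 0.
    by rewrite mulf_neq0 ?(gt_eqF s0) // mulf_neq0 ?(gt_eqF C0).
  apply/eqP; rewrite -(mulrI_eq0 _ (lregP nz')); apply/eqP.
  have E2 := congr1 (fun y => a1 * C * k ^+ 2 * b * y) e2.
  by move: ev E2; rewrite a12; set b' := b; lra.
by rewrite a12 a10.
Qed.

End Crossing.

(** * Rational approximation *)

Lemma near0_rational (R : realType) (P : set R) :
  nbhs (0 : R) P -> exists2 q : rat, q != 0 & P (ratr q).
Proof.
move=> /nbhs_ballP[e /= e0 eP]; have [q] := rat_in_itvoo e0.
rewrite in_itv /= => /andP[q0 qe]; exists q.
  by apply/eqP => qE; move: q0; rewrite qE rmorph0 ltxx.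
by apply: eP; rewrite /ball /= sub0r normrN gtr0_norm.
Qed.

Section Frames.
Context (R : realType) (K : fieldExtType rat) (iota : {rmorphism K -> R}).
Context (n : nat) (A : 'M[K]_n.+1).
Hypothesis admA : admissible iota A.
Local Notation f := (map_mx iota A).
Let fsym : f^T = f := real_form_sym admA.

Lemma rational_frame (x v : 'rV[R]_n.+1) (O : set ('rV[R]_n.+1 * 'rV[R]_n.+1)) :
  qform f x = -1 -> qform f v = 1 -> bform f x v = 0 -> nbhs (x, v) O ->
  exists (e u : 'rV[K]_n.+1) (a b : R) (y z : 'rV[R]_n.+1),
    [/\ map_mx iota e = a *: y, map_mx iota u = b *: z, a != 0 & b != 0] /\
    [/\ qform f y = -1, qform f z = 1, bform f y z = 0 & O (y, z)].
Proof.
move=> qx qv bxv xvO.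
have bvx : bform f v x = 0 by rewrite bformC.
have [Asym _ _ _] := admA.
pose V := 'rV[R]_n.+1.
pose Z (p : V * V) := p.2 + (- (bform f p.2 p.1 / qform f p.1)) *: p.1.
have c1 : p.1 @[p --> (x, v)] --> x by exact: cvg_fst.
have c2 : p.2 @[p --> (x, v)] --> v by exact: cvg_snd.
have cq : qform f p.1 @[p --> (x, v)] --> (-1 : R).
  by rewrite -qx; exact: cvg_qform.
have cZ : Z p @[p --> (x, v)] --> v.
  rewrite -[X in _ --> X]addr0 -(scale0r x); apply: cvgD => //.
  apply: cvgZ => //; rewrite -oppr0; apply: cvgN.
  rewrite -(mul0r (-1)^-1) -bvx; apply: cvgM; first exact: cvg_bform.
  by apply: cvgV; rewrite ?oppr_eq0 ?oner_eq0.
have cqZ : qform f (Z p) @[p --> (x, v)] --> (1 : R).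
  by rewrite -qv; exact: cvg_qform.
have cY' : (Num.sqrt (- qform f p.1))^-1 *: p.1 @[p --> (x, v)] --> x.
  have := cvgZ (cvg_invsqrt ltr01 _) c1; rewrite sqrtr1 invr1 scale1r; apply.
  by rewrite -[X in _ --> X]opprK; apply: cvgN.
have cZ' : (Num.sqrt (qform f (Z p)))^-1 *: Z p @[p --> (x, v)] --> v.
  by have := cvgZ (cvg_invsqrt ltr01 cqZ) cZ; rewrite sqrtr1 invr1 scale1r;
    apply.
have : \forall p \near (x, v), [/\ qform f p.1 < 0, 0 < qform f (Z p) &
    O ((Num.sqrt (- qform f p.1))^-1 *: p.1, (Num.sqrt (qform f (Z p)))^-1 *: Z
      p)].
  near=> p; split; near: p.
  - by apply: (cvgr_lt _ cq); rewrite ltrN10.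
  - by apply: (cvgr_gt _ cqZ).
  - exact: (cvg_pair cY' cZ' xvO).
move=> [[P Q] /= [xP vQ] PQ].
have [e Pe] := near_rational iota xP.
have [u0 Qu0] := near_rational iota vQ.
have [/= qe qZ OYZ] := PQ (map_mx iota e, map_mx iota u0) (conj Pe Qu0).
pose u := u0 - (bform A u0 e / qform A e) *: e.
have uE : map_mx iota u = Z (map_mx iota e, map_mx iota u0).
  rewrite /Z /= map_bform map_qform -fmorph_div scaleNr.
  by rewrite map_mxB map_mxZ.
set y := (_ *: map_mx iota e) in OYZ; set z := (_ *: Z _) in OYZ.
have eu : bform f (map_mx iota e) (map_mx iota u) = 0.
  rewrite map_bform /u -scaleNr bformDr bformZr (bformC _ _ Asym) mulNr.
  by rewrite divfK ?subrr ?rmorph0 // -(fmorph_eq0 iota) -map_qform lt_eqF.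
have s1 : 0 < Num.sqrt (- qform f (map_mx iota e)) by rewrite sqrtr_gt0
  oppr_gt0.
have s2 : 0 < Num.sqrt (qform f (map_mx iota u)) by rewrite sqrtr_gt0 uE.
exists e, u, (Num.sqrt (- qform f (map_mx iota e))), (Num.sqrt (qform f (map_mx
  iota u))), y, z.
split; split.
- by rewrite /y scalerA mulfV ?scale1r // gt_eqF.
- by rewrite /z -uE scalerA mulfV ?scale1r // gt_eqF.
- by rewrite gt_eqF.
- by rewrite gt_eqF.
- rewrite /y qformZ exprVn sqr_sqrtr ?oppr_ge0 ?ltW // invrN mulNr mulVf //
    lt_eqF //.
- by rewrite /z -uE qformZ exprVn sqr_sqrtr uE ?ltW // mulVf // gt_eqF.
- by rewrite /y /z -uE bformZl bformZr eu !mulr0.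
- by [].
Unshelve. all: by end_near. Qed.

Lemma rational_orthogonal (e u : 'rV[K]_n.+1) : (2 <= n)%N ->
  exists w : 'rV[K]_n.+1, [/\ w != 0, bform A w e = 0 & bform A w u = 0].
Proof.
move=> n2; pose N := kermx (A *m (col_mx e u)^T).
have N0 : N != 0.
  rewrite -mxrank_eq0 mxrank_ker -lt0n subn_gt0.
  by apply: leq_ltn_trans (rank_leq_col _) _.
have [i Ni] : exists i, row i N != 0.
  apply/existsP; rewrite -negb_forall; apply: contra N0 => /forallP N0.
  by apply/eqP/row_matrixP => i; rewrite row0; apply/eqP.
exists (row i N); split=> //.
  have := mulmx_ker (A *m (col_mx e u)^T).
  move=> /(congr1 (row i)); rewrite row0 !row_mul -/N tr_col_mx mulmxA
    mul_mx_row => /eqP.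
  by rewrite -row_mx0 => /eqP/eq_row_mx[Ne _]; rewrite /bform Ne mxE.
have := mulmx_ker (A *m (col_mx e u)^T).
move=> /(congr1 (row i)); rewrite row0 !row_mul -/N tr_col_mx mulmxA mul_mx_row
  => /eqP.
by rewrite -row_mx0 => /eqP/eq_row_mx[_ Nu]; rewrite /bform Nu mxE.
Qed.

(* The factor [k] normalizes [y + d *: w]. *)
Lemma rational_tilt (e u : 'rV[K]_n.+1) (a b c : R) (y z : 'rV[R]_n.+1)
    (O : set 'rV[R]_n.+1) :
  (2 <= n)%N ->
  map_mx iota e = a *: y -> map_mx iota u = b *: z -> a != 0 -> b != 0 ->
  qform f y = -1 -> qform f z = 1 -> bform f y z = 0 -> nbhs y O ->
    c ^+ 2 < 1 ->
  exists (w : 'rV[R]_n.+1) (d k : R) (e' : 'rV[K]_n.+1),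
    let p := k *: (y + d *: w) in
    [/\ bform f w y = 0, bform f w z = 0, 0 < qform f w, d != 0 & 0 < k] /\
    [/\ map_mx iota e' = (a / k) *: p, qform f p = -1, bform f p z = 0, O p &
        (k * c) ^+ 2 < 1].
Proof.
move=> n2 ey uz a0 b0 qy qz byz yO c1.
have funit := real_form_unit admA; have [_ _ fneg _] := admA.
have [w0 [w00 w0e w0u]] := rational_orthogonal e u n2.
pose w := map_mx iota w0.
have wy : bform f w y = 0.
  by apply: (mulfI a0); rewrite -bformZr -ey map_bform w0e rmorph0 mulr0.
have wz : bform f w z = 0.
  by apply: (mulfI b0); rewrite -bformZr -uz map_bform w0u rmorph0 mulr0.
have qw : 0 < qform f w.
  apply: (timelike_orthogonal_gt0 fsym funit fneg _ wy);
    first by rewrite qy ltrN10.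
  by rewrite map_mx_eq0.
pose D (t : R) := t / a.
pose k t := (Num.sqrt (1 - D t ^+ 2 * qform f w))^-1.
have cD : D t @[t --> (0 : R)] --> (0 : R).
  rewrite -[X in _ --> X](mul0r a^-1); apply: cvgM;
    [exact: cvg_id | exact: cvg_cst].
have c1D : 1 - D t ^+ 2 * qform f w @[t --> (0 : R)] --> (1 : R).
  have := cvgB (cvg_cst (1 : R)) (cvgM (cvgM cD cD) (cvg_cst (qform f w))).
  by rewrite !mul0r subr0; apply.
have ck : k t @[t --> (0 : R)] --> (1 : R).
  by have := cvg_invsqrt ltr01 c1D; rewrite sqrtr1 invr1; apply.
have cp : k t *: (y + D t *: w) @[t --> (0 : R)] --> y.
  have := cvgZ ck (cvgD (cvg_cst y) (cvgZ cD (cvg_cst w))).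
  by rewrite scale0r addr0 scale1r; apply.
have ckc : (k t * c) ^+ 2 @[t --> (0 : R)] --> c ^+ 2.
  by have := cvgM (cvgM ck (cvg_cst c)) (cvgM ck (cvg_cst c)); rewrite mul1r;
    apply.
have : \forall t \near (0 : R), [/\ 0 < 1 - D t ^+ 2 * qform f w,
    (k t * c) ^+ 2 < 1 & O (k t *: (y + D t *: w))].
  near=> t; split; near: t.
  - exact: (cvgr_gt _ c1D).
  - exact: (cvgr_lt _ ckc).
  - exact: cp.
move=> /near0_rational[q q0 [Dq kq Op]].
set d := D (ratr q) in Dq kq Op; set k' := k (ratr q) in kq Op.
have k0 : 0 < k' by rewrite invr_gt0 sqrtr_gt0.
have kE : k' ^+ 2 * (1 - d ^+ 2 * qform f w) = 1.
  by rewrite exprVn sqr_sqrtr ?ltW // mulVf // gt_eqF.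
have yw : bform f y w = 0 by rewrite bformC.
exists w, d, k', (e + in_alg K q *: w0); split; split=> //.
- by rewrite mulf_neq0 ?invr_neq0 // fmorph_eq0.
- rewrite map_mxD map_mxZ ey -/w scalerA divfK ?gt_eqF // scalerDr scalerA.
  rewrite /d /D mulrCA mulfV // mulr1; congr (_ + _ *: _).
  by rewrite -[iota _]/((iota \o in_alg K) _) fmorph_eq_rat.
- rewrite qformZ qformD // qformZ bformZr yw qy mulr0 mul0rn addr0; move: kE;
    lra.
- by rewrite bformZl bformDl bformZl byz wz mulr0 addr0 mulr0.
Unshelve. all: by end_near. Qed.

End Frames.

Lemma Oprime_hyperboloid (R : realType) (K : fieldExtType rat)
    (iota : {rmorphism K -> R}) (m : nat) (A : 'M[K]_m) (L : set 'rV[K]_m)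
    (o : 'rV[R]_m) (g : 'M[R]_m) (x : 'rV[R]_m) :
  negative_cone (map_mx iota A) o -> Oprime iota A L g ->
  hyperboloid (map_mx iota A) o x -> hyperboloid (map_mx iota A) o (x *m g).
Proof.
move=> no [isog _ stable] [qx cx]; split; first by rewrite isog.
by rewrite -(stable o no); exists x.
Qed.

Theorem theorem1p3 (R : realType) (K : fieldExtType rat)
    (iota : {rmorphism K -> R}) (n : nat) (A : 'M[K]_n.+1)
    (L : set 'rV[K]_n.+1) (Gamma : mxgroup R n.+1) (o : 'rV[R]_n.+1) :
  (2 <= n)%N ->
  totally_real R K ->
  admissible iota A ->
  is_lattice L ->
  arithmetic_lattice_typeI iota A L Gamma ->
  negative_cone (map_mx iota A) o ->
  compact [set: manifold (map_mx iota A) o Gamma] ->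
  dense (nonsimple_closed_tangents (map_mx iota A) o Gamma).
Proof.
move=> n2 Kreal admA latL [GammaO _ Gammatf] no compactM O [u0 Ou0] openO.
set f := map_mx iota A.
have fsym : f^T = f := real_form_sym admA.
have Ghyp g x : mxgroup_set Gamma g -> hyperboloid f o x ->
  hyperboloid f o (x *m g).
  by move=> /GammaO; exact: Oprime_hyperboloid.
have [r rP] := compact_bounded_orbits Ghyp compactM.
have boost := rational_boost Kreal admA latL GammaO Gammatf (r := r).
pose X : set_type (unit_tangent f o) := repr u0.
have XO : O (projT1 Gamma X) by rewrite /projT1 reprK.
have [W openW WO] : open (projT1 Gamma @^-1` O) by exact: openO.
have /= [hx bxv qv] := set_valP X.
set x := (set_val X).1 in hx bxv; set v := (set_val X).2 in bxv qv.
have [qx cx] := hx.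
have xvW : nbhs (x, v) W.
  apply: open_nbhs_nbhs; split => //.
  have : (projT1 Gamma @^-1` O) X by [].
  by rewrite -WO /= /x /v; case: (set_val X).
have xvS : nbhs (x, v) [set p | W p /\ bform f x p.1 < 0].
  apply: filterI => //.
  have cb : bform f x p.1 @[p --> (x, v)] --> (-1 : R).
    by rewrite -qx; apply: cvg_bform; [exact: cvg_cst | exact: cvg_fst].
  by apply: (cvgr_lt _ cb); rewrite ltrN10.
have S_hyp y : qform f y = -1 -> bform f x y < 0 -> hyperboloid f o y.
  move=> qy bxy; split=> //; apply: connected_component_trans cx _.
  by apply: same_sheet => //; rewrite ?qx ?qy ltrN10.
have [e [u [a [b [y [z [[ey uz a0 b0] [qy qz byz [Wyz bxy]]]]]]]]] :=
  rational_frame admA qx qv bxv xvS.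
have hy : hyperboloid f o y by exact: S_hyp.
have [h Gh [l l0 [yh zh wh]]] : exists2 h, mxgroup_set Gamma h &
    exists2 l : R, l != 0 &
    [/\ y *m h = cosh l *: y + sinh l *: z, z *m h = sinh l *: y + cosh l *: z &
        forall w, bform f w y = 0 -> bform f w z = 0 -> w *m h = w].
  by apply: (boost y z e u a b) => // t; apply: rP; exact: line_hyperboloid.
pose c := sinh l / (cosh l + 1).
have c1 : c ^+ 2 < 1.
  have ch := cosh_gt0 l; have chsh := cosh2_sinh2 l.
  have pos : 0 < (cosh l + 1) ^+ 2 by rewrite exprn_gt0 // addr_gt0.
  rewrite -(ltr_pM2r pos) -exprMn divfK ?mul1r;
    last by rewrite gt_eqF ?addr_gt0.
  by lra.
have yO : nbhs y [set p | W (p, z) /\ bform f x p < 0].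
  have cy : p @[p --> y] --> y by exact: cvg_id.
  apply: filterI.
    have yzW : nbhs (y, z) W by exact: open_nbhs_nbhs.
    exact: (cvg_pair cy (cvg_cst z) yzW).
  apply: (cvgr_lt _ (cvg_bform (cvg_cst x) cy)) => //.
have [w [d [k [e' [[wy wz qw d0 k0] [e'E qp bpz [Wp bxp] kc]]]]]] :=
  rational_tilt admA n2 ey uz a0 b0 qy qz byz yO c1.
set p := k *: (y + d *: w) in e'E qp bpz Wp bxp.
have hp : hyperboloid f o p by exact: S_hyp.
have [g Gg [m m0 [pg zg _]]] : exists2 g, mxgroup_set Gamma g &
    exists2 m : R, m != 0 &
    [/\ p *m g = cosh m *: p + sinh m *: z, z *m g = sinh m *: p + cosh m *: z &
        forall w, bform f w p = 0 -> bform f w z = 0 -> w *m g = w].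
  apply: (boost p z e' u (a / k) b) => //.
    by rewrite mulf_neq0 ?invr_neq0 // gt_eqF.
  by move=> t; apply: rP; exact: line_hyperboloid.
have [t [pt freet]] :=
  line_crossing fsym qz byz wy wz qw yh zh (wh w wy wz) l0 d0 k0 kc.
have pz : unit_tangent f o (p, z) by [].
pose X' : set_type (unit_tangent f o) := SigSub (mem_set pz).
exists (projT1 Gamma X'); split.
  have : W (set_val X') by [].
  by rewrite -[W _]/((set_val @^-1` W) X') WO.
exists (line_lift fsym hp qz bpz); split.
- exact: (closed_line_lift fsym hp qz bpz Gg m0 pg zg).
- exists (- t), t, h; split=> //.
  by rewrite velocity_line_lift.
- exists 0, X'; split=> //; rewrite velocity_line_lift position_line_lift.
  by rewrite /line cosh0 sinh0 !scale1r !scale0r !addr0.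
Qed.
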